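(* For every $1$-Lipschitz map $T:\mathbb{R}^2\to\mathbb{R}^2$ (Euclidean norm), every Borel probability measure $\mu$ on $\mathbb{R}^2$, every $s>0$, and every convex function $U:[0,\infty)\to\mathbb{R}$ with $U(0)=0$, $$\int_{\mathbb{R}^2} U\big((\mu*\gamma_s)(x)\big)\,dx\;\le\;\int_{\mathbb{R}^2} U\big((T_\#\mu*\gamma_s)(x)\big)\,dx .$$
   Context: Here $\gamma_s(x)=(2\pi s)^{-1}e^{-\|x\|_2^2/(2s)}$ is the isotropic Gaussian density with variance $s$ on $\mathbb{R}^2$; $\mu*\gamma_s$ denotes the density $x\mapsto\int\gamma_s(x-y)\,d\mu(y)$; $T_\#\mu$ is the push-forward of $\mu$ by $T$. The integrals take values in the extended reals. *)

(* Defs.v *)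
From HB Require Import structures.
From mathcomp Require Import all_boot all_order all_algebra.
From mathcomp Require Import all_classical all_reals all_analysis.
Set Implicit Arguments.
Unset Strict Implicit.
Unset Printing Implicit Defensive.
Import Order.TTheory GRing.Theory Num.Theory.
Import numFieldNormedType.Exports.

Local Open Scope classical_set_scope.
Local Open Scope ring_scope.

(* [measurableTypeR R] is [R] with its Borel sigma-algebra, so the product
   sigma-algebra is the Borel sigma-algebra of the plane. *)
Notation plane R := (measurableTypeR R * measurableTypeR R)%type.

Notation lebesgue2 R := (@lebesgue_measure R \x @lebesgue_measure R)%E.

(* The library norm on a product of normed spaces is the max norm, so the
   Euclidean norm is spelled out; for the same reason the library's
   [k.-lipschitz] cannot be used below. *)
Definition norm2 (R : realType) (x : plane R) : R :=
  Num.sqrt (x.1 ^+ 2 + x.2 ^+ 2).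

Definition lipschitz1_norm2 (R : realType) (T : plane R -> plane R) : Prop :=
  forall x y : plane R, norm2 (T x - T y) <= norm2 (x - y).

(* The parameter [s] is the variance, not the standard deviation. *)
Definition gauss2 (R : realType) (s : R) (x : plane R) : R :=
  (2 * pi * s)^-1 * expR (- (norm2 x ^+ 2 / (2 * s))).

(* [m] is only required to be a set function so that [pushforward mu T] can be
   used without carrying a proof that [T] is measurable (a Lipschitz map always
   is). For a probability measure [m] and [0 < s] the integral lies between 0
   and [(2 * pi * s)^-1], so [fine] loses nothing. *)
Definition gauss_conv (R : realType) (m : set (plane R) -> \bar R) (s : R)
    (x : plane R) : R :=
  fine (\int[m]_y (gauss2 s (x - y))%:E)%E.

(* Main.v *)
From HB Require Import structures.
Require Import Defs.
From mathcomp Require Import all_boot all_order all_algebra.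
From mathcomp Require Import all_classical all_reals all_analysis.
From mathcomp Require Import measurable_realfun ring lra.
Set Implicit Arguments.
Unset Strict Implicit.
Unset Printing Implicit Defensive.
Import Order.TTheory GRing.Theory Num.Theory.
Import numFieldNormedType.Exports.
Local Open Scope classical_set_scope.
Local Open Scope ring_scope.

(** On the bounded range of the densities, U(t) = c t - V(t) with V concave and
    nondecreasing, hence a limit of sums of c_k min(t, a_k) with c_k >= 0.  So it
    suffices to treat U(t) = max(t - a, 0), and by Fatou only for finitely
    supported mu.

    Lift to R^4: with e(x) = exp(-|x|^2 / 2s) and f(x, y) = e(y) sum_i w_i e(x - p_i),
    the integral over y of f 1_{f > a} is proportional to
    max(sum_i w_i e(x - p_i) - a, 0), because under Lebesgue measure on R^2 the
    disc of squared radius v has area proportional to v.  It remains to compare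
    the integral of f 1_{f > a} at the two ends of the path
    P_i(t) = (c(t) p_i, g(t) T p_i), c^2 + g^2 = 1, from (p_i, 0) to (0, T p_i),
    along which all distances |P_i - P_j| decrease.

    Replace 1_{f > a} by a smoother nondecreasing G(f).  Recentring at each
    P_i,
      int f G(f) = sum_i w_i int e(z) G(sum_j w_j e(z + P_i - P_j)) dz,
    and to first order the change of the inner argument, symmetrized in i and j,
    is -(1/2s) w_i w_j (P_i - P_j).(dP_i - dP_j) times a nonnegative factor; so
    the integral grows up to an error quadratic in the step, which subdivision
    of the path removes. *)

(** * Lebesgue measure on the plane: translations and dilations *)

(* A named copy of [lebesgue2 R]: inference does not find the library's
   sigma-finite structure on the product measure itself. *)
Definition leb2 (R : realType) := lebesgue2 R.
Arguments leb2 : clear implicits.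

Section leb2_sigma_finite.
Context (R : realType).

HB.instance Definition _ := Measure.on (leb2 R).

Let leb2_sigma_finite : sigma_finite setT (leb2 R).
Proof.
have /sigma_finiteP[F [TF ndF Foo]] := sigma_finiteT (@lebesgue_measure R).
exists (fun n => F n `*` F n).
  rewrite -setXTT TF predeqE => -[x y]; split.
    move=> [/= [n _ Fnx] [k _ Gky]]; exists (maxn n k) => //; split.
    - by move: x Fnx; exact/subsetPset/ndF/leq_maxl.
    - by move: y Gky; exact/subsetPset/ndF/leq_maxr.
  by move=> [n _ []/= ? ?]; split; exists n.
move=> k; have [mF Fk] := Foo k; split; first exact: measurableX.
by rewrite /leb2 product_measure1E// lte_mul_pinfty// ge0_fin_numE.
Qed.

HB.instance Definition _ :=
  Measure_isSigmaFinite.Build _ _ _ (leb2 R) leb2_sigma_finite.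

End leb2_sigma_finite.

Section product_map.
Context d1 d2 (T1 : measurableType d1) (T2 : measurableType d2) (R : realType).
Variables (m1 : {sigma_finite_measure set T1 -> \bar R})
          (m2 : {sigma_finite_measure set T2 -> \bar R}).

(** Tonelli treats the two coordinates one after the other, so the Jacobian factors multiply. It is
    applied to R x R and then once more to R^2 x R^2. *)
Lemma ge0_integral_prod_map (p1 : T1 -> T1) (p2 : T2 -> T2) (c1 c2 : R) :
  measurable_fun setT p1 -> measurable_fun setT p2 -> 0 <= c1 -> 0 <= c2 ->
  (forall f : T1 -> \bar R, measurable_fun setT f -> (forall x, 0 <= f x)%E ->
    \int[m1]_x f (p1 x) = c1%:E * \int[m1]_x f x)%E ->
  (forall f : T2 -> \bar R, measurable_fun setT f -> (forall x, 0 <= f x)%E ->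
    \int[m2]_x f (p2 x) = c2%:E * \int[m2]_x f x)%E ->
  forall f : T1 * T2 -> \bar R, measurable_fun setT f -> (forall x, 0 <= f x)%E ->
  (\int[m1 \x m2]_x f (p1 x.1, p2 x.2) = (c1 * c2)%:E * \int[m1 \x m2]_x f x)%E.
Proof.
move=> mp1 mp2 c10 c20 H1 H2 f mf f0.
have mF : measurable_fun setT (fun x => \int[m2]_y f (x, y))%E.
  exact: (measurable_fun_fubini_tonelli_F (m2 := m2) f mf f0).
rewrite !fubini_tonelli1//; last first.
  apply: (measurableT_comp mf); apply: measurable_fun_pair.
    exact: (measurableT_comp mp1).
  exact: (measurableT_comp mp2).
rewrite /fubini_F/=.
under eq_integral => x _.
  rewrite (H2 (fun y => f (p1 x, y)))//; last exact: measurable_fun_pair2.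
  over.
rewrite ge0_integralZl//=; last 2 first.
- exact: (measurableT_comp mF mp1).
- by move=> x _; exact: integral_ge0.
rewrite (H1 (fun x => \int[m2]_y f (x, y))%E)//; last by move=> x; exact: integral_ge0.
by rewrite muleA -EFinM mulrC.
Qed.

End product_map.

Section lebesgue_affine.
Context (R : realType).
Local Notation leb := (@lebesgue_measure R).
Local Notation aff a b := ((fun x => a * x + b) : measurableTypeR R -> measurableTypeR R).

Lemma measurable_affine (a b : R) : measurable_fun setT (aff a b).
Proof. by apply: measurable_funD => //; exact: measurable_funM. Qed.

(** The scaled push-forward is a measure with the right values on half-open intervals, so uniqueness
    of Lebesgue measure applies. *)
Lemma lebesgue_measure_affine (a b : R) (A : set (measurableTypeR R)) : 0 < a ->
  measurable A -> (leb A = a%:E * leb (aff a b @^-1` A))%E.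
Proof.
move=> a0 mA.
pose nu : {measure set (measurableTypeR R) -> \bar R} :=
  mscale (NngNum (ltW a0)) (pushforward leb (aff a b)).
rewrite [LHS](@lebesgue_measure_unique R (nu (measurable_affine a b)))// => _ [[x y]] _ <-.
rewrite /nu/= /mscale/= /pushforward.
have -> : aff a b @^-1` `]x, y] = `](x - b) / a, (y - b) / a]%classic.
  by apply/seteqP; split=> z /=; rewrite !in_itv/= ltr_pdivrMr// ler_pdivlMr// ltrBlDr lerBrDr mulrC.
rewrite !lebesgue_measure_itv/= !lte_fin ltr_pM2r ?invr_gt0// ltrD2r.
case: ifP => _; last by rewrite mule0.
rewrite -!EFinD -EFinM -mulrBl; congr EFin.
by field; rewrite gt_eqF.
Qed.

Lemma ge0_integral_affine (a b : R) (f : measurableTypeR R -> \bar R) : 0 < a ->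
  measurable_fun setT f -> (forall x, 0 <= f x)%E ->
  (\int[leb]_x f (a * x + b)%R = (a^-1)%:E * \int[leb]_x f x)%E.
Proof.
move=> a0 mf f0.
pose nu : {measure set (measurableTypeR R) -> \bar R} :=
  mscale (NngNum (ltW a0)) (pushforward leb (aff a b)).
have -> : (\int[leb]_x f x = \int[nu (measurable_affine a b)]_x f x)%E.
  by apply: eq_measure_integral => A mA _; exact: lebesgue_measure_affine.
rewrite /nu ge0_integral_mscale//.
rewrite (ge0_integral_pushforward (measurable_affine a b))//.
rewrite preimage_setT/=.
by rewrite muleA -EFinM mulVf ?gt_eqF// mul1e.
Qed.

Lemma leb2_scale (r : R) (f : plane R -> \bar R) : 0 < r ->
  measurable_fun setT f -> (forall x, 0 <= f x)%E ->
  (\int[leb2 R]_x f (r * x.1, r * x.2)%R = (r^-1 ^+ 2)%:E * \int[leb2 R]_x f x)%E.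
Proof.
move=> r0 mf f0; rewrite expr2.
rewrite -(ge0_integral_prod_map (p1 := aff r 0) (p2 := aff r 0))//.
- by apply: eq_integral => x _; rewrite !addr0.
- exact: measurable_affine.
- exact: measurable_affine.
- by rewrite invr_ge0 ltW.
- by rewrite invr_ge0 ltW.
- by move=> g mg g0; exact: ge0_integral_affine.
- by move=> g mg g0; exact: ge0_integral_affine.
Qed.

Lemma leb2_translate (v : plane R) (f : plane R -> \bar R) :
  measurable_fun setT f -> (forall x, 0 <= f x)%E ->
  (\int[leb2 R]_x f (x + v)%R = \int[leb2 R]_x f x)%E.
Proof.
move=> mf f0.
rewrite -[RHS]mul1e -[in RHS](mulr1 1).
rewrite -(ge0_integral_prod_map (p1 := aff 1 v.1) (p2 := aff 1 v.2))//.
- by apply: eq_integral => x _; rewrite !mul1r.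
- exact: measurable_affine.
- exact: measurable_affine.
- by move=> g mg g0; rewrite ge0_integral_affine// invr1.
- by move=> g mg g0; rewrite ge0_integral_affine// invr1.
Qed.

Lemma measurable_translate2 (v : plane R) : measurable_fun setT (fun x : plane R => x + v).
Proof.
apply: (measurable_fun_pair (f := fun x : plane R => (x.1 : measurableTypeR R) + v.1 : measurableTypeR R)
  (g := fun x : plane R => (x.2 : measurableTypeR R) + v.2 : measurableTypeR R)).
  by apply: measurable_funD.
by apply: measurable_funD.
Qed.

Lemma leb4_translate (v : plane R * plane R) (f : plane R * plane R -> \bar R) :
  measurable_fun setT f -> (forall x, 0 <= f x)%E ->
  (\int[leb2 R \x leb2 R]_x f (x + v)%R = \int[leb2 R \x leb2 R]_x f x)%E.
Proof.
move=> mf f0.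
rewrite -[RHS]mul1e -[in RHS](mulr1 1).
rewrite -(ge0_integral_prod_map (p1 := fun x : plane R => x + v.1)
  (p2 := fun x : plane R => x + v.2))//.
- exact: measurable_translate2.
- exact: measurable_translate2.
- by move=> g mg g0; rewrite leb2_translate// mul1e.
- by move=> g mg g0; rewrite leb2_translate// mul1e.
Qed.

End lebesgue_affine.

(** * One step of the contraction in an inner product space *)

Section saturation.
Context (R : realType).

(* Increases to the indicator of [u > a] as [n] grows; its only kink is convex,
   hence the one-sided Taylor bound [satur_semiconvex]. *)
Definition satur (a n u : R) : R :=
  1 - (1 + n * Num.max (u - a) 0)^-1.

(** Derivative of [satur a n], with the left derivative 0 at the kink [u = a]. *)
Definition dsatur (a n u : R) : R :=
  if a < u then n / (1 + n * (u - a)) ^+ 2 else 0.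

Variables (a n : R).
Hypothesis n0 : 0 <= n.

Let den_ge1 u : 1 <= 1 + n * Num.max (u - a) 0.
Proof. by rewrite lerDl mulr_ge0// le_max lexx orbT. Qed.

Lemma satur_ge0 u : 0 <= satur a n u.
Proof. by rewrite subr_ge0 invf_le1 ?den_ge1// (lt_le_trans ltr01). Qed.

Lemma satur_le1 u : satur a n u <= 1.
Proof. by rewrite gerBl invr_ge0 (le_trans ler01). Qed.

Lemma dsatur_ge0 u : 0 <= dsatur a n u.
Proof. by rewrite /dsatur; case: ifP => // _; rewrite divr_ge0// sqr_ge0. Qed.

Lemma dsatur_le u : dsatur a n u <= n.
Proof.
rewrite /dsatur; case: ifP => // au.
have h : 1 <= (1 + n * (u - a)) ^+ 2.
  by rewrite exprn_ege1// lerDl mulr_ge0// subr_ge0 ltW.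
by rewrite ler_pdivrMr ?(lt_le_trans ltr01)// ler_peMr.
Qed.

Lemma satur_semiconvex u v :
  satur a n u + dsatur a n u * (v - u) - n ^+ 2 * (v - u) ^+ 2 <= satur a n v.
Proof.
rewrite /dsatur; case: ltP => [au|ua]; last first.
  have -> : satur a n u = 0 by rewrite /satur max_r ?subr_le0// mulr0 addr0 invr1 subrr.
  rewrite mul0r addr0 sub0r (le_trans _ (satur_ge0 v))// oppr_le0.
  by rewrite mulr_ge0// sqr_ge0.
rewrite {1}/satur max_l ?subr_ge0 ?(ltW au)//.
set w := u - a; have w0 : 0 < w by rewrite subr_gt0.
have Dw : 1 <= 1 + n * w by rewrite lerDl mulr_ge0// ltW.
have Dw0 : 0 < 1 + n * w by exact: lt_le_trans Dw.
case: (lerP a v) => [av|va].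
  rewrite /satur max_l ?subr_ge0//.
  set t := v - a; have t0 : 0 <= t by rewrite subr_ge0.
  have Dt : 1 <= 1 + n * t by rewrite lerDl mulr_ge0.
  have Dt0 : 0 < 1 + n * t by exact: lt_le_trans Dt.
  have -> : v - u = t - w by rewrite /t /w; ring.
  rewrite -subr_ge0.
  (* Exact Taylor remainder on the smooth branch, where the second derivative is at least
     [- 2 * n ^+ 2]. *)
  have -> : 1 - (1 + n * t)^-1 - (1 - (1 + n * w)^-1 + n / (1 + n * w) ^+ 2 * (t - w) -
      n ^+ 2 * (t - w) ^+ 2) =
      n ^+ 2 * (t - w) ^+ 2 * (1 - ((1 + n * w) ^+ 2 * (1 + n * t))^-1).
    by field; rewrite !gt_eqF.
  apply: mulr_ge0; first by rewrite mulr_ge0// sqr_ge0.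
  rewrite subr_ge0 invf_le1; last by rewrite mulr_gt0// exprn_gt0.
  by rewrite -[leLHS]mulr1 ler_pM// exprn_ege1.
have -> : satur a n v = 0 by rewrite /satur max_r ?subr_le0 ?(ltW va)// mulr0 addr0 invr1 subrr.
set t := a - v; have t0 : 0 < t by rewrite subr_gt0.
have -> : v - u = - (t + w) by rewrite /t /w; ring.
rewrite -oppr_ge0.
have -> : - (1 - (1 + n * w)^-1 + n / (1 + n * w) ^+ 2 * - (t + w) - n ^+ 2 * (- (t + w)) ^+ 2) =
  (n * t + n ^+ 2 * ((t + w) ^+ 2 * (1 + n * w) ^+ 2 - w ^+ 2)) / (1 + n * w) ^+ 2.
  by field; rewrite !gt_eqF.
have tw : w ^+ 2 <= (t + w) ^+ 2.
  by have : 0 < t * w by [exact: mulr_gt0]; nra.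
have wD : w ^+ 2 * 1 <= (t + w) ^+ 2 * (1 + n * w) ^+ 2.
  by rewrite ler_pM ?sqr_ge0// exprn_ege1.
rewrite mulr1 in wD.
apply: divr_ge0; last exact: sqr_ge0.
by rewrite addr_ge0 ?mulr_ge0 ?sqr_ge0 ?(ltW t0)// subr_ge0.
Qed.

End saturation.

Section abstract_gaussian.
Context (R : realType) (V : zmodType) (dot : V -> V -> R).
Hypothesis dotC : forall u v, dot u v = dot v u.
Hypothesis dotD : forall u v t, dot (u + v) t = dot u t + dot v t.
Hypothesis dot_ge0 : forall u, 0 <= dot u u.
Hypothesis dot_CS : forall u v, dot u v ^+ 2 <= dot u u * dot v v.
Variable s : R.
Hypothesis s0 : 0 < s.

Let dotDr u v t : dot u (v + t) = dot u v + dot u t.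
Proof. by rewrite dotC dotD !(dotC _ u). Qed.

Let dot0 u : dot 0 u = 0.
Proof. by apply: (addrI (dot 0 u)); rewrite -dotD !addr0. Qed.

Let dotN u v : dot (- u) v = - dot u v.
Proof. by apply/eqP; rewrite -addr_eq0 -dotD addNr dot0. Qed.

Let dotNr u v : dot u (- v) = - dot u v.
Proof. by rewrite dotC dotN dotC. Qed.

(** An unnormalised Gaussian for an abstract form, so that one kernel serves both R^2 and R^4. *)
Definition gker (u : V) : R := expR (- (dot u u / (2 * s))).

Let gker_gt0 u : 0 < gker u. Proof. exact: expR_gt0. Qed.

Let gker_ge0 u : 0 <= gker u. Proof. exact/ltW. Qed.

Let gker_le1 u : gker u <= 1.
Proof. by rewrite -expR0 ler_expR oppr_le0 divr_ge0// mulr_ge0// ltW. Qed.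

(** Expanding the square in the exponent leaves a factor [expR (- dot u d / s - dot d d / (2 * s))],
    to which [1 + x <= expR x] applies. *)
Lemma gker_tangent u d :
  gker u * (1 - dot u d / s - dot d d / (2 * s)) <= gker (u + d).
Proof.
have -> : gker (u + d) = gker u * expR (- (dot u d / s) - dot d d / (2 * s)).
  rewrite -expRD; congr expR; rewrite dotD !dotDr (dotC d u).
  by field; rewrite gt_eqF.
by rewrite ler_pM2l// -addrA expR_ge1Dx.
Qed.

(** With y = |u|^2 / s this is y exp(-y) <= 1; it keeps the gradient of the kernel bounded. *)
Let gker_sq_dot u : gker u ^+ 2 * dot u u <= s.
Proof.
have -> : gker u ^+ 2 = expR (- (dot u u / s)).
  by rewrite expr2 -expRD; congr expR; field; rewrite gt_eqF.
rewrite -ler_pdivlMl ?expR_gt0// -expRN opprK mulrC -ler_pdivrMl//.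
by rewrite mulrC (le_trans _ (expR_ge1Dx _))// lerDr.
Qed.

(** Square of a Lipschitz constant for increments of length at most 1: it comes from (x + y)^2 <= 2
    x^2 + 2 y^2 with x^2 <= |d|^2 / s and y^2 <= |d|^2 / (4 s^2). *)
Definition gker_lip := 2 / s + (2 * s ^+ 2)^-1.

Lemma gker_lip_ge0 : 0 <= gker_lip.
Proof. by rewrite addr_ge0// ?divr_ge0 ?invr_ge0 ?mulr_ge0 ?sqr_ge0// ltW. Qed.

Let gker_decr_bound u d : dot d d <= 1 -> 0 <= gker u - gker (u + d) ->
  (gker u - gker (u + d)) ^+ 2 <= gker_lip * dot d d.
Proof.
move=> d1 h.
set dd := dot d d in d1 *; have dd0 : 0 <= dd by exact: dot_ge0.
set x := gker u * dot u d / s.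
set y := dd / (2 * s).
have y0 : 0 <= y by rewrite divr_ge0// mulr_ge0// ltW.
have le1 : gker u - gker (u + d) <= `|x| + y.
  rewrite lerBlDr -lerBlDl; apply: le_trans (gker_tangent u d).
  rewrite !mulrBr mulr1 opprD addrA lerD//.
    by rewrite lerB// /x mulrA ler_norm.
  by rewrite lerN2 ler_piMl.
have x2 : x ^+ 2 <= dd / s.
  rewrite /x exprMn exprMn.
  have := dot_CS u d; rewrite -/dd => CS.
  have : gker u ^+ 2 * dot u d ^+ 2 <= s * dd.
    apply: (le_trans (ler_wpM2l (sqr_ge0 _) CS)).
    by rewrite mulrA ler_wpM2r.
  move=> H; apply: (le_trans (ler_wpM2r (sqr_ge0 _) H)).
  by rewrite le_eqVlt; apply/orP; left; apply/eqP; field; rewrite gt_eqF.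
have y2 : y ^+ 2 <= dd / (4 * s ^+ 2).
  have -> : y ^+ 2 = dd * (dd / (4 * s ^+ 2)) by rewrite /y; field; rewrite gt_eqF.
  by rewrite ler_piMl// divr_ge0// mulr_ge0// sqr_ge0.
have : (gker u - gker (u + d)) ^+ 2 <= (`|x| + y) ^+ 2.
  by rewrite ler_sqr// nnegrE ?addr_ge0// subr_ge0 -subr_ge0.
move=> /le_trans; apply.
have : (`|x| + y) ^+ 2 <= 2 * `|x| ^+ 2 + 2 * y ^+ 2.
  rewrite -subr_ge0.
  have -> : 2 * `|x| ^+ 2 + 2 * y ^+ 2 - (`|x| + y) ^+ 2 = (`|x| - y) ^+ 2 by ring.
  exact: sqr_ge0.
rewrite real_normK ?num_real// => /le_trans; apply.
apply: (le_trans (lerD (ler_wpM2l _ x2) (ler_wpM2l _ y2))) => //.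
by rewrite le_eqVlt; apply/orP; left; apply/eqP; rewrite /gker_lip; field; rewrite gt_eqF.
Qed.

Lemma gker_lipschitz u d e : dot d d <= e -> e <= 1 ->
  `|gker (u + d) - gker u| <= Num.sqrt (gker_lip * e).
Proof.
move=> de e1; rewrite distrC -sqrtr_sqr.
rewrite ler_sqrt ?mulr_ge0 ?gker_lip_ge0 ?(le_trans (dot_ge0 d))//.
apply: (@le_trans _ _ (gker_lip * dot d d)); last first.
  by rewrite ler_wpM2l// gker_lip_ge0.
have d1 := le_trans de e1.
have [h|h] := leP 0 (gker u - gker (u + d)); first exact: gker_decr_bound.
(* An increase from [u] to [u + d] is a decrease from [u + d] under the increment [- d]. *)
rewrite -sqrrN opprB.
have := @gker_decr_bound (u + d) (- d); rewrite addrK dotN dotNr opprK; apply => //.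
by rewrite -oppr_le0 opprB ltW.
Qed.

Section step.
Variables (I : Type) (r : seq I) (w : I -> R).
Hypothesis w0 : forall i, 0 <= w i.

Definition gmix (P : I -> V) (x : V) := \sum_(i <- r) w i * gker (x - P i).

Let W := \sum_(i <- r) w i.

(** Error per unit of [e]: the second-order part of the kernel tangent, weighted by the bound [n] on
    [dsatur], plus the quadratic term of [satur_semiconvex] under the Lipschitz bound. *)
Definition step_cst (n : R) := n * W / (2 * s) + n ^+ 2 * W ^+ 2 * gker_lip.

(* Exchanging [i] and [j] turns the first-order terms into multiples of
   [- dot (P i - P j) (d i - d j)]; everything else is of order [e]. *)
Lemma gmix_step (a n e : R) (P d : I -> V) (x : V) : 0 <= n -> e <= 1 ->
  (forall i j, dot (P i - P j) (d i - d j) <= 0) ->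
  (forall i j, dot (d i - d j) (d i - d j) <= e) ->
  gmix P x * satur a n (gmix P x) <=
  \sum_(i <- r) w i * gker (x - P i) *
     satur a n (gmix (fun j => P j + d j) (x + d i)) + step_cst n * e * gmix P x.
Proof.
move=> n0 e1 Pd de.
have W0 : 0 <= W by exact: sumr_ge0.
set f0 := gmix P x; set G0 := satur a n f0; set g0 := dsatur a n f0.
pose E i := gker (x - P i).
(* First-order change of the inner argument in the term recentred at [P i]. *)
pose S i := \sum_(j <- r) w j * E j * (- (dot (x - P j) (d i - d j) / s)).
have E0 i : 0 <= E i by exact: gker_ge0.
have e0 (i : I) : 0 <= e by exact: le_trans (dot_ge0 _) (de i i).
have key i : G0 + g0 * S i - step_cst n * e <=
    satur a n (gmix (fun j => P j + d j) (x + d i)).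
  set f1 := gmix _ _.
  (* Seen from the moving centre [P i], only the relative displacement [d i - d j] enters. *)
  have f1E : f1 = \sum_(j <- r) w j * gker (x - P j + (d i - d j)).
    by apply: eq_bigr => j _; congr (_ * gker _); rewrite opprD addrACA.
  have low : S i - W * e / (2 * s) <= f1 - f0.
    rewrite f1E /f0 /gmix -sumrB /S /W !mulr_suml -sumrB.
    apply: ler_sum => j _; rewrite -mulrBr -!mulrA -mulrBr ler_wpM2l//.
    rewrite lerBrDl; apply: le_trans (gker_tangent (x - P j) (d i - d j)).
    rewrite -/(E j) !mulrDr mulr1 -addrA lerD2l lerD2l mulrN lerN2.
    apply: (@le_trans _ _ (dot (d i - d j) (d i - d j) / (2 * s))).
      by rewrite ler_piMl// ?gker_le1// divr_ge0// mulr_ge0// ltW.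
    by rewrite ler_wpM2r// ?de// invr_ge0 mulr_ge0// ltW.
  have upp : (f1 - f0) ^+ 2 <= W ^+ 2 * (gker_lip * e).
    rewrite -[X in _ <= _ * X]sqr_sqrtr ?mulr_ge0 ?gker_lip_ge0 ?(e0 i)//.
    rewrite -exprMn -real_normK ?num_real//.
    rewrite ler_sqr ?nnegrE ?mulr_ge0 ?sqrtr_ge0//.
    rewrite f1E /f0 /gmix -sumrB (le_trans (ler_norm_sum _ _ _))// /W mulr_suml.
    apply: ler_sum => j _; rewrite -mulrBr normrM ger0_norm// ler_wpM2l//.
    exact: gker_lipschitz.
  apply: le_trans (satur_semiconvex a n0 f0 f1).
  rewrite -/G0 -/g0 /step_cst.
  have h1 : g0 * S i - n * (W * e / (2 * s)) <= g0 * (f1 - f0).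
    apply: (@le_trans _ _ (g0 * (S i - W * e / (2 * s)))).
      rewrite mulrBr lerB// ler_wpM2r ?dsatur_le//.
      by rewrite divr_ge0 ?mulr_ge0// ?(e0 i)// ltW.
    by rewrite ler_wpM2l// dsatur_ge0.
  have h2 := ler_wpM2l (sqr_ge0 n) upp.
  have -> : (n * W / (2 * s) + n ^+ 2 * W ^+ 2 * gker_lip) * e =
    n * (W * e / (2 * s)) + n ^+ 2 * (W ^+ 2 * (gker_lip * e)) by ring.
  rewrite opprD addrA; apply: lerD; last by rewrite lerN2.
  by rewrite -addrA lerD2l.
have sym : 0 <= \sum_(i <- r) w i * E i * S i.
  rewrite -(pmulr_rge0 _ (ltr0Sn _ 1)) mulr2n mulrDl mul1r.
  have SE : \sum_(i <- r) w i * E i * S i =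
    \sum_(i <- r) \sum_(j <- r) w i * E i * (w j * E j) * (- (dot (x - P j) (d i - d j) / s)).
    by apply: eq_bigr => i _; rewrite mulr_sumr; apply: eq_bigr => j _; rewrite mulrA.
  rewrite {1}SE SE [X in _ + X]exchange_big/= -big_split/=.
  apply: sumr_ge0 => i _; rewrite -big_split/=; apply: sumr_ge0 => j _.
  have -> : w i * E i * (w j * E j) * - (dot (x - P j) (d i - d j) / s) +
      w j * E j * (w i * E i) * - (dot (x - P i) (d j - d i) / s) =
      w i * E i * (w j * E j) * - (dot (P i - P j) (d i - d j)) / s.
    rewrite -(opprB (d i) (d j)) dotNr !dotD !dotN.
    by field; rewrite gt_eqF.
  apply: mulr_ge0; last by rewrite invr_ge0 ltW.
  by apply: mulr_ge0; rewrite ?oppr_ge0// !mulr_ge0.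
have f0E : f0 = \sum_(i <- r) w i * E i by [].
rewrite {1}f0E.
apply: (@le_trans _ _ (\sum_(i <- r) (w i * E i * (G0 + g0 * S i)))).
  under [leRHS]eq_bigr do rewrite mulrDr.
  rewrite big_split/= mulr_suml lerDl.
  have -> : \sum_(i <- r) w i * E i * (g0 * S i) = g0 * \sum_(i <- r) w i * E i * S i.
    by rewrite mulr_sumr; apply: eq_bigr => i _; ring.
  by rewrite mulr_ge0// dsatur_ge0.
rewrite f0E mulr_sumr -big_split/=; apply: ler_sum => i _.
rewrite [X in _ <= _ + X]mulrC -mulrDr ler_wpM2l ?mulr_ge0//.
by rewrite -lerBlDr.
Qed.

End step.
End abstract_gaussian.

(** * Inner products on R^2 and R^4, and measurability of the kernels *)

Section dots.
Context (R : realType).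

Definition dot2 (u v : plane R) : R := u.1 * v.1 + u.2 * v.2.

Definition dot4 (u v : plane R * plane R) : R := dot2 u.1 v.1 + dot2 u.2 v.2.

Lemma dot2C u v : dot2 u v = dot2 v u.
Proof. by rewrite /dot2; ring. Qed.

Lemma dot2D u v t : dot2 (u + v) t = dot2 u t + dot2 v t.
Proof. by rewrite /dot2/=; ring. Qed.

Lemma dot2_ge0 u : 0 <= dot2 u u.
Proof. by rewrite addr_ge0// -expr2 sqr_ge0. Qed.

Lemma dot4C u v : dot4 u v = dot4 v u.
Proof. by rewrite /dot4 !(dot2C u.1) !(dot2C u.2). Qed.

Lemma dot4D u v t : dot4 (u + v) t = dot4 u t + dot4 v t.
Proof. by rewrite /dot4/= !dot2D addrACA. Qed.

Lemma dot4_ge0 u : 0 <= dot4 u u.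
Proof. by rewrite addr_ge0// dot2_ge0. Qed.

(** Lagrange's identity: the defect is the sum of the squares of the six 2x2 minors. *)
Lemma dot4_CS u v : dot4 u v ^+ 2 <= dot4 u u * dot4 v v.
Proof.
move: u v => [[a b] [c d]] [[x y] [z t]]; rewrite /dot4 /dot2/= -subr_ge0.
have -> : (a * a + b * b + (c * c + d * d)) * (x * x + y * y + (z * z + t * t)) -
  (a * x + b * y + (c * z + d * t)) ^+ 2 =
  (a * y - b * x) ^+ 2 + (a * z - c * x) ^+ 2 + (a * t - d * x) ^+ 2 +
  (b * z - c * y) ^+ 2 + (b * t - d * y) ^+ 2 + (c * t - d * z) ^+ 2 by ring.
by rewrite !addr_ge0// sqr_ge0.
Qed.

Lemma gker4E (s : R) x : gker dot4 s x = gker dot2 s x.1 * gker dot2 s x.2.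
Proof. by rewrite /gker -expRD /dot4 mulrDl opprD. Qed.

Lemma measurable_gker2 (s : R) (v : plane R) :
  measurable_fun setT (fun x : plane R => gker dot2 s (x - v)).
Proof.
rewrite (_ : (fun x => _) = expR \o (fun x : plane R =>
  - (((x.1 : R) - v.1) ^+ 2 + ((x.2 : R) - v.2) ^+ 2) * (2 * s)^-1)); last first.
  by apply/funext => x /=; rewrite /gker /dot2/= -!expr2 mulNr.
apply: measurableT_comp => //; apply: measurable_funM => //; apply: measurable_funN.
by apply: measurable_funD; apply: measurable_funX; exact: measurable_funB.
Qed.

Lemma measurable_gker4 (s : R) (v : plane R * plane R) :
  measurable_fun setT (fun x : plane R * plane R => gker dot4 s (x - v)).
Proof.
under eq_fun do rewrite gker4E.
apply: measurable_funM.
  exact: (measurableT_comp (measurable_gker2 s v.1) measurable_fst).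
exact: (measurableT_comp (measurable_gker2 s v.2) measurable_snd).
Qed.

Lemma satur_ndecr (a n u v : R) : 0 <= n -> u <= v -> satur a n u <= satur a n v.
Proof.
move=> n0 uv; rewrite /satur lerB// lef_pV2 ?posrE.
- by rewrite lerD2l ler_wpM2l// ge_max !le_max lexx lerB// orbT.
- by rewrite ltr_pwDl// mulr_ge0// le_max lexx orbT.
- by rewrite ltr_pwDl// mulr_ge0// le_max lexx orbT.
Qed.

Lemma measurable_satur (a n : R) : 0 <= n -> measurable_fun setT (satur a n).
Proof.
by move=> n0; apply: nondecreasing_measurable => // u v; exact: satur_ndecr.
Qed.

End dots.

(** * Removing quadratic errors by subdivision *)

Section subdivision.
Context (R : realType).

(** Over N equal steps the quadratic errors add up to K (b - a)^2 / N, which is arbitrarily small.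
    [D] limits the step size for which the hypothesis is available. *)
Lemma subdivision_le (F : R -> \bar R) (a b D K : R) : a <= b -> 0 <= D -> 0 <= K ->
  (forall t u, a <= t -> t <= u -> u <= b -> D * (u - t) ^+ 2 <= 1 ->
    (F t <= F u + (K * (u - t) ^+ 2)%:E)%E) ->
  (F a <= F b)%E.
Proof.
move=> ab D0 K0 H.
apply/lee_addgt0Pr => e e0.
set L := b - a; have L0 : 0 <= L by rewrite subr_ge0.
(* Each summand serves one purpose: N > c makes the steps admissible, D L^2 <= N <= N^2, and the
   total error K L^2 / N at most e. *)
set c := D * L ^+ 2 + K * L ^+ 2 / e.
have c0 : 0 <= c by rewrite addr_ge0 ?mulr_ge0 ?sqr_ge0 ?invr_ge0// ltW.
pose N := (Num.truncn c).+1.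
have cN : c < N%:R by rewrite truncnS_gt.
have N0 : 0 < N%:R :> R by rewrite ltr0n.
pose t k : R := a + L * (k%:R / N%:R).
have tS k : t k.+1 - t k = L / N%:R by rewrite /t -natr1; field; rewrite gt_eqF.
have DN : D * (L / N%:R) ^+ 2 <= 1.
  rewrite expr_div_n mulrA ler_pdivrMr ?exprn_gt0// mul1r.
  apply: (@le_trans _ _ N%:R); last by rewrite ler_eXnr// ler1n.
  by apply: le_trans (ltW cN); rewrite lerDl divr_ge0 ?mulr_ge0 ?sqr_ge0 ?(ltW e0).
have step k : (k < N)%N -> (F (t k) <= F (t k.+1) + (K * (L / N%:R) ^+ 2)%:E)%E.
  move=> kN; rewrite -(tS k); apply: H; rewrite ?tS//.
  - by rewrite lerDl !mulr_ge0// invr_ge0.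
  - by rewrite -subr_ge0 tS divr_ge0.
  - have kN1 : k.+1%:R / N%:R <= 1 :> R by rewrite ler_pdivrMr// mul1r ler_nat.
    by rewrite /t -lerBrDl -/L ler_piMr.
have all k : (k <= N)%N -> (F (t 0%N) <= F (t k) + (k%:R * (K * (L / N%:R) ^+ 2))%:E)%E.
  elim: k => [_|k IH kN]; first by rewrite mul0r adde0.
  apply: (le_trans (IH (ltnW kN))).
  apply: (le_trans (leeD2r _ (step _ kN))).
  by rewrite -addeA -EFinD -[k.+1%:R]natr1 [(k%:R + 1) * _]mulrDl mul1r [K * _ + _]addrC.
have := all N (leqnn _).
have -> : t 0%N = a by rewrite /t mul0r mulr0 addr0.
have -> : t N = b by rewrite /t divff ?gt_eqF// mulr1 /L addrC subrK.
move=> /le_trans; apply; rewrite leeD2l// lee_fin.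
have -> : N%:R * (K * (L / N%:R) ^+ 2) = K * L ^+ 2 / N%:R by field; rewrite gt_eqF.
rewrite ler_pdivrMr// -ler_pdivrMl// mulrC.
by apply: le_trans (ltW cN); rewrite lerDr mulr_ge0// sqr_ge0.
Qed.

End subdivision.

(** * Integration of the step over R^4 *)

Section integrated_step.
Context (R : realType) (s : R) (s0 : 0 < s).
Local Notation X4 := (plane R * plane R)%type.
Local Notation leb4 := (leb2 R \x leb2 R)%E.
Variables (I : Type) (r : seq I) (w : I -> R).
Hypothesis w0 : forall i, 0 <= w i.

Local Notation mix := (gmix (@dot4 R) s r w).

Lemma measurable_gmix4 (P : I -> X4) : measurable_fun setT (mix P).
Proof.
by apply: measurable_sum => i; apply: measurable_funM => //; exact: measurable_gker4.
Qed.

Lemma gmix4_ge0 (P : I -> X4) x : 0 <= mix P x.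
Proof. by apply: sumr_ge0 => i _; rewrite mulr_ge0// expR_ge0. Qed.

Definition energy (a n : R) (P : I -> X4) : \bar R :=
  (\int[leb4]_x (mix P x * satur a n (mix P x))%:E)%E.

(** By translation invariance the mass does not depend on the centres, which makes the error of
    [energy_step] uniform along the path. *)
Lemma integral_gmix4 (P : I -> X4) :
  (\int[leb4]_x (mix P x)%:E =
   (\sum_(i <- r) w i)%:E * \int[leb4]_x (gker (@dot4 R) s x)%:E)%E.
Proof.
have m0 : measurable_fun setT (fun x => gker (@dot4 R) s x).
  by have := measurable_gker4 s (0 : X4); under eq_fun do rewrite subr0.
under eq_integral do rewrite -sumEFin.
rewrite ge0_integral_sum//; last 2 first.
- move=> i; apply/measurable_EFinP; apply: measurable_funM => //.
  exact: measurable_gker4.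
- by move=> i x _; rewrite lee_fin mulr_ge0// expR_ge0.
rewrite -sumEFin ge0_sume_distrl//; last by move=> i _; rewrite lee_fin.
apply: eq_bigr => i _.
under eq_integral do rewrite EFinM.
rewrite ge0_integralZl//; last 3 first.
- by apply/measurable_EFinP; exact: measurable_gker4.
- by move=> x _; rewrite lee_fin expR_ge0.
- by rewrite lee_fin.
congr (_ * _)%E.
apply: (@leb4_translate R (- P i) (fun x => (gker (@dot4 R) s x)%:E)).
  exact/measurable_EFinP.
by move=> x; rewrite lee_fin expR_ge0.
Qed.

(** Integrating [gmix_step]: translating the i-th term by [d i] reassembles the recentred terms into
    the energy of the displaced centres. *)
Lemma energy_step (a n e : R) (P d : I -> X4) : 0 <= n -> 0 <= e -> e <= 1 ->
  (forall i j, dot4 (P i - P j) (d i - d j) <= 0) ->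
  (forall i j, dot4 (d i - d j) (d i - d j) <= e) ->
  (energy a n P <= energy a n (fun i => P i + d i)%R +
     (step_cst s r w n * e)%:E * \int[leb4]_x (mix P x)%:E)%E.
Proof.
move=> n0 e0 e1 Pd de.
have C0 : 0 <= step_cst s r w n * e.
  have W0 : 0 <= \sum_(i <- r) w i by exact: sumr_ge0.
  have s20 : 0 <= (2 * s)^-1 by rewrite invr_ge0 mulr_ge0// ltW.
  rewrite mulr_ge0// addr_ge0//; first by rewrite !mulr_ge0.
  by apply: mulr_ge0; rewrite ?gker_lip_ge0// mulr_ge0// sqr_ge0.
set Q := fun i => P i + d i.
have mG f : measurable_fun setT f -> measurable_fun setT (fun x : X4 => satur a n (f x)).
  move=> mf; exact: (measurableT_comp (measurable_satur a n0) mf).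
pose h i (x : X4) := w i * gker (@dot4 R) s (x - Q i) * satur a n (mix Q x).
have h0 i x : 0 <= h i x.
  apply: mulr_ge0; last exact: satur_ge0.
  apply: mulr_ge0; [exact: w0|exact: expR_ge0].
have mh i : measurable_fun setT (h i).
  apply: measurable_funM; last exact: (mG _ (measurable_gmix4 Q)).
  by apply: measurable_funM => //; exact: measurable_gker4.
have mT (v : X4) : measurable_fun setT (fun x : X4 => x + v).
  apply: measurable_fun_pair.
    exact: (measurableT_comp (measurable_translate2 v.1) measurable_fst).
  exact: (measurableT_comp (measurable_translate2 v.2) measurable_snd).
have mhd i : measurable_fun setT (fun x : X4 => h i (x + d i)).
  exact: (measurableT_comp (mh i) (mT (d i))).
have EQ : energy a n Q = (\sum_(i <- r) \int[leb4]_x (h i (x + d i)%R)%:E)%E.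
  transitivity (\sum_(i <- r) \int[leb4]_x (h i x)%:E)%E.
    rewrite -ge0_integral_sum//; last 2 first.
    - by move=> i; exact/measurable_EFinP.
    - by move=> i x _; rewrite lee_fin.
    by apply: eq_integral => x _; rewrite sumEFin -mulr_suml.
  apply: eq_bigr => i _.
  apply/esym/(@leb4_translate R (d i) (fun x => (h i x)%:E)).
    by apply/measurable_EFinP; exact: mh.
  by move=> x; rewrite lee_fin.
set C := step_cst s r w n * e in C0 *.
have mf := measurable_gmix4 P.
have pt (x : X4) : mix P x * satur a n (mix P x) <= \sum_(i <- r) h i (x + d i) + C * mix P x.
  have -> : \sum_(i <- r) h i (x + d i) =
      \sum_(i <- r) w i * gker (@dot4 R) s (x - P i) * satur a n (mix Q (x + d i)).
    apply: eq_bigr => i _; rewrite /h /Q; congr (_ * gker _ _ _ * _).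
    by rewrite opprD addrACA subrr addr0.
  exact: (gmix_step (@dot4C R) (@dot4D R) (@dot4_ge0 R) (@dot4_CS R)).
apply: (@le_trans _ _ (\int[leb4]_x ((\sum_(i <- r) h i (x + d i))%R%:E + (C * mix P x)%:E))%E).
  apply: ge0_le_integral => //.
  - by move=> x _; rewrite lee_fin mulr_ge0 ?satur_ge0// gmix4_ge0.
  - apply/measurable_EFinP; apply: measurable_funM; first exact: mf.
    exact: (mG _ mf).
  - apply: emeasurable_funD; apply/measurable_EFinP; first exact: measurable_sum.
    exact: measurable_funM.
  - by move=> x _; rewrite -EFinD lee_fin.
rewrite ge0_integralD//; last 4 first.
- by move=> x _; rewrite lee_fin sumr_ge0.
- by apply/measurable_EFinP; exact: measurable_sum.
- by move=> x _; rewrite lee_fin mulr_ge0// gmix4_ge0.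
- by apply/measurable_EFinP; exact: measurable_funM.
rewrite EQ leeD//.
  under eq_integral do rewrite -sumEFin.
  rewrite ge0_integral_sum//; last 2 first.
  - by move=> i; exact/measurable_EFinP.
  - by move=> i x _; rewrite lee_fin.
under eq_integral do rewrite EFinM.
rewrite ge0_integralZl//.
- exact/measurable_EFinP.
- by move=> x _; rewrite lee_fin gmix4_ge0.
Qed.

End integrated_step.

(** * The path from (p, 0) to (0, T p) *)

Section gaussian_mass.
Context (R : realType) (s : R) (s0 : 0 < s).
Local Notation leb := (@lebesgue_measure R).

Definition gauss_mass := (\int[leb2 R]_x (gker (@dot2 R) s x)%:E)%E.

Lemma measurable_gker0 : measurable_fun setT (fun x : plane R => gker (@dot2 R) s x).
Proof. by have := measurable_gker2 s (0 : plane R); under eq_fun do rewrite subr0. Qed.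

Lemma gauss_mass_ge0 : (0 <= gauss_mass)%E.
Proof. by apply: integral_ge0 => x _; rewrite lee_fin expR_ge0. Qed.

(** The kernel splits into two one-dimensional Gaussians, each a dilation of exp(-x^2). *)
Lemma gauss_mass_lty : (gauss_mass < +oo)%E.
Proof.
pose a := Num.sqrt (2 * s)^-1.
have a0 : 0 < a by rewrite sqrtr_gt0 invr_gt0 mulr_gt0.
have aE x : expR (- (x ^+ 2 / (2 * s))) = expR (- (a * x + 0) ^+ 2).
  by rewrite addr0 exprMn sqr_sqrtr ?invr_ge0 ?mulr_ge0 ?(ltW s0)// mulrC.
pose c := (\int[leb]_x (expR (- (x ^+ 2 / (2 * s))))%:E)%E.
have c0 : (0 <= c)%E by apply: integral_ge0 => x _; rewrite lee_fin expR_ge0.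
have clty : (c < +oo)%E.
  rewrite /c; under eq_integral do rewrite aE.
  rewrite (@ge0_integral_affine R a 0 (fun x => (expR (- x ^+ 2))%:E) a0).
  - by rewrite integralT_gauss -EFinM ltry.
  - by apply/measurable_EFinP; exact: measurable_gauss_fun.
  - by move=> x; rewrite lee_fin expR_ge0.
have -> : gauss_mass = (c * c)%E.
  rewrite /gauss_mass /leb2 fubini_tonelli1//; last 2 first.
  - by apply/measurable_EFinP; exact: measurable_gker0.
  - by move=> x; rewrite lee_fin expR_ge0.
  have mE : measurable_fun setT (fun x : measurableTypeR R => (expR (- (x ^+ 2 / (2 * s))))%:E).
    apply/measurable_EFinP; apply: measurableT_comp => //; apply: measurable_funN.
    by apply: measurable_funM => //; exact: measurable_funX.
  rewrite {2}/c -ge0_integralZl//.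
  apply: eq_integral => x _; rewrite /fubini_F muleC /c -ge0_integralZl//.
  apply: eq_integral => y _; rewrite -EFinM -expRD; congr (expR _)%:E.
  by rewrite /dot2/= -!expr2 mulrDl opprD.
by rewrite lte_mul_pinfty// ge0_fin_numE.
Qed.

Lemma gauss_mass4 :
  (\int[leb2 R \x leb2 R]_x (gker (@dot4 R) s x)%:E = gauss_mass * gauss_mass)%E.
Proof.
rewrite fubini_tonelli1//; last 2 first.
- apply/measurable_EFinP.
  by have := measurable_gker4 s (0 : plane R * plane R); under eq_fun do rewrite subr0.
- by move=> x; rewrite lee_fin expR_ge0.
have mE : measurable_fun setT (fun x : plane R => (gker (@dot2 R) s x)%:E).
  by apply/measurable_EFinP; exact: measurable_gker0.
rewrite {1}/gauss_mass -ge0_integralZr//; last 2 first.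
- by move=> x _; rewrite lee_fin expR_ge0.
- exact: gauss_mass_ge0.
apply: eq_integral => x _; rewrite /fubini_F /gauss_mass -ge0_integralZl//; last 2 first.
- by move=> y _; rewrite lee_fin expR_ge0.
- by rewrite lee_fin expR_ge0.
by apply: eq_integral => y _; rewrite gker4E EFinM.
Qed.

End gaussian_mass.

Section rotation.
Context (R : realType) (s : R) (s0 : 0 < s).
Local Notation X4 := (plane R * plane R)%type.
Variables (I : Type) (r : seq I) (w : I -> R) (p q : I -> plane R) (D : R).
Hypothesis w0 : forall i, 0 <= w i.
Hypothesis pq : forall i j,
  dot2 (q i - q j) (q i - q j) <= dot2 (p i - p j) (p i - p j).
Hypothesis pD : forall i j, dot2 (p i - p j) (p i - p j) <= D.
Hypothesis D0 : 0 <= D.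

Definition scale2 (c : R) (v : plane R) : plane R := (c * v.1, c * v.2).

(* Rational parametrization of the quarter circle. *)
Let c (t : R) := (1 - t ^+ 2) / (1 + t ^+ 2).
Let g (t : R) := 2 * t / (1 + t ^+ 2).
Let path (t : R) (i : I) : X4 := (scale2 (c t) (p i), scale2 (g t) (q i)).

Let den0 (t : R) : 0 < 1 + t ^+ 2.
Proof. by rewrite ltr_pwDl// sqr_ge0. Qed.

(** Squared distance between the points with parameters [t] and [u] on the unit circle. *)
Let chord (t u : R) := 4 * (u - t) ^+ 2 / ((1 + t ^+ 2) * (1 + u ^+ 2)).

Let chordE t u : (c u - c t) ^+ 2 + (g u - g t) ^+ 2 = chord t u.
Proof. by rewrite /c /g /chord; field; rewrite !gt_eqF. Qed.

(** Unit vectors satisfy x.(y - x) = -|y - x|^2 / 2. *)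
Let cos_chord t u : c t * (c u - c t) + g t * (g u - g t) = - (chord t u / 2).
Proof. by rewrite /c /g /chord; field; rewrite !gt_eqF. Qed.

Let chord_ge0 t u : 0 <= chord t u.
Proof. by apply: divr_ge0; [rewrite mulr_ge0// sqr_ge0|rewrite ltW// mulr_gt0]. Qed.

Let chord_le t u : chord t u <= 4 * (u - t) ^+ 2.
Proof.
have h : 1 * 1 <= (1 + t ^+ 2) * (1 + u ^+ 2) by rewrite ler_pM ?lerDl ?sqr_ge0.
rewrite /chord ler_pdivrMr; last by rewrite mulr_gt0.
rewrite mulr1 in h.
by rewrite -[leLHS]mulr1; apply: ler_wpM2l; rewrite // mulr_ge0// sqr_ge0.
Qed.

Let pathD t u i : path u i = path t i + (path u i - path t i).
Proof. by rewrite addrC subrK. Qed.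

Let dot_path (x y : plane R) (c1 g1 c2 g2 : R) :
  dot4 (scale2 c1 x, scale2 g1 y) (scale2 c2 x, scale2 g2 y) =
  c1 * c2 * dot2 x x + g1 * g2 * dot2 y y.
Proof. by rewrite /dot4 /dot2 /scale2/=; ring. Qed.

Let path_diff t i j : path t i - path t j =
  (scale2 (c t) (p i - p j), scale2 (g t) (q i - q j)).
Proof. by rewrite /path /scale2; congr (_, _); congr (_, _) => /=; rewrite mulrBr. Qed.

Let path_diff2 t u i j : path u i - path t i - (path u j - path t j) =
  (scale2 (c u - c t) (p i - p j), scale2 (g u - g t) (q i - q j)).
Proof.
by rewrite /path /scale2; congr (_, _); congr (_, _) => /=; rewrite mulrBl !mulrBr; ring.
Qed.

(** Squared distances along the path are c^2 A + g^2 B, where B <= A are the squared distances of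
    the q's and of the p's. Since c decreases while c^2 + g^2 = 1, they shrink, so [energy_step]
    applies to every short piece. *)
Lemma energy_rotation (a n : R) : 0 <= n ->
  (energy s r w a n (fun i => (p i, 0%R)) <= energy s r w a n (fun i => (0%R, q i)))%E.
Proof.
move=> n0.
have -> : (fun i => (p i, 0)) = path 0 :> (I -> X4).
  apply/funext => i; rewrite /path /c /g /scale2 expr0n/= mulr0 addr0 subr0 divr1 !mul0r !mul1r.
  by congr (_, _); case: (p i).
have -> : (fun i => (0, q i)) = path 1 :> (I -> X4).
  apply/funext => i; rewrite /path /c /g /scale2 expr1n mulr1 -mulr2n divff ?pnatr_eq0//.
  by rewrite subrr !mul0r !mul1r; congr (_, _); case: (q i).
set W := \sum_(i <- r) w i.
have W0 : 0 <= W by exact: sumr_ge0.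
set m := fine (gauss_mass s * gauss_mass s)%E.
have m0 : 0 <= m by rewrite fine_ge0// mule_ge0// gauss_mass_ge0.
have mass t : (\int[leb2 R \x leb2 R]_x (gmix (@dot4 R) s r w (path t) x)%:E = (W * m)%:E)%E.
  rewrite integral_gmix4// gauss_mass4// EFinM fineK// ge0_fin_numE ?mule_ge0 ?gauss_mass_ge0//.
  by rewrite lte_mul_pinfty ?gauss_mass_ge0 ?gauss_mass_lty// ge0_fin_numE ?gauss_mass_ge0 ?gauss_mass_lty.
have C0 : 0 <= step_cst s r w n.
  have s20 : 0 <= (2 * s)^-1 by rewrite invr_ge0 mulr_ge0// ltW.
  rewrite /step_cst -/W addr_ge0//; first by rewrite !mulr_ge0.
  by apply: mulr_ge0; rewrite ?gker_lip_ge0// mulr_ge0// sqr_ge0.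
(* By [chord_le], [4 * D * (u - t) ^+ 2] bounds the squared relative displacements and serves as the
   [e] of [energy_step]; the mass is [W * m] at every parameter. *)
apply: (@subdivision_le R (fun t => energy s r w a n (path t)) 0 1 (4 * D)
  (step_cst s r w n * (4 * D) * (W * m))) => //.
- by rewrite mulr_ge0.
- by rewrite !mulr_ge0.
move=> t u t0 tu u1 small.
set e := 4 * D * (u - t) ^+ 2 in small *.
have e0 : 0 <= e by rewrite mulr_ge0 ?sqr_ge0 ?mulr_ge0.
have ct1 v : 0 <= v -> v <= 1 -> 0 <= c v.
  by move=> v0 v1; rewrite divr_ge0 ?(ltW (den0 v))// subr_ge0 exprn_ile1.
have gt0 v : 0 <= v -> 0 <= g v.
  by move=> v0; rewrite divr_ge0 ?(ltW (den0 v))// mulr_ge0.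
have cut : c u - c t <= 0.
  have -> : c u - c t = - (2 * (u - t) * (u + t) / ((1 + u ^+ 2) * (1 + t ^+ 2))).
    by rewrite /c; field; rewrite !gt_eqF.
  rewrite oppr_le0; apply: divr_ge0; last by rewrite ltW// mulr_gt0.
  by apply: mulr_ge0; rewrite ?mulr_ge0 ?subr_ge0// addr_ge0// (le_trans t0).
have -> : path u = (fun i => path t i + (path u i - path t i)).
  by apply/funext => i; exact: pathD.
have -> : (step_cst s r w n * (4 * D) * (W * m) * (u - t) ^+ 2)%:E =
    ((step_cst s r w n * e)%:E * (W * m)%:E)%E.
  by rewrite -EFinM /e; congr EFin; ring.
rewrite -(mass t).
apply: energy_step => //.
- move=> i j; rewrite path_diff path_diff2 dot_path.
  have := cos_chord t u; have := chord_ge0 t u.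
  set A := dot2 (p i - p j) _; set B := dot2 (q i - q j) _.
  have B0 : 0 <= B by exact: dot2_ge0.
  have BA : B <= A by exact: pq.
  have t1 : t <= 1 by exact: le_trans u1.
  move=> ch0 che.
  have h1 : c t * (c u - c t) <= 0 by rewrite mulr_ge0_le0// ct1.
  (* Replacing A by the smaller B raises this nonpositive term; the coefficient of B is then
     [- (chord t u / 2)]. *)
  have h2 : c t * (c u - c t) * A <= c t * (c u - c t) * B by rewrite ler_wnM2l.
  apply: (le_trans (lerD h2 (lexx _))).
  rewrite -mulrDl che mulNr oppr_le0 mulr_ge0// divr_ge0//.
- move=> i j; rewrite path_diff2 dot_path -!expr2.
  set A := dot2 (p i - p j) _; set B := dot2 (q i - q j) _.
  have BA : B <= A by exact: pq.
  have A0 : 0 <= A by exact: dot2_ge0.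
  have AD : A <= D by exact: pD.
  apply: (@le_trans _ _ (chord t u * A)).
    rewrite -chordE [leRHS]mulrDl; apply: lerD; first by rewrite expr2.
    by apply: ler_wpM2l; rewrite -?expr2 ?sqr_ge0.
  have -> : e = 4 * (u - t) ^+ 2 * D by rewrite /e; ring.
  by apply: ler_pM.
Qed.

End rotation.

(** * Integrals of super-level sets of the Gaussian *)

Section disc.
Context (R : realType) (s : R) (s0 : 0 < s).
Local Notation leb := (@lebesgue_measure R).
Local Notation e2 := (gker (@dot2 R) s).

(** Indexed by the squared radius, in which the area is linear. *)
Definition disc (v : R) : set (plane R) := [set z | dot2 z z < v].

Lemma measurable_dot2 : measurable_fun setT (fun z : plane R => dot2 z z).
Proof. by apply: measurable_funD; apply: measurable_funM. Qed.

Lemma measurable_disc v : measurable (disc v).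
Proof.
rewrite (_ : disc v = (fun z : plane R => dot2 z z) @^-1` `]-oo, v[).
  by rewrite -[X in measurable X]setTI; apply: measurable_dot2.
by apply/seteqP; split => z /=; rewrite in_itv.
Qed.

(** Kept as a positive constant: it enters only through [disc_cst], which cancels in
    [finite_hinge_le]. *)
Let area1 := fine (leb2 R (disc 1)).

Let disc1_lty : (leb2 R (disc 1) < +oo)%E.
Proof.
apply: (@le_lt_trans _ _ (leb2 R (`](-1)%R, 1%R[ `*` `](-1)%R, 1%R[))).
  apply: le_measure; rewrite ?inE//; [exact: measurable_disc|exact: measurableX|].
  move=> [x y]; rewrite /disc /dot2/= -!expr2 !in_itv/= => h.
  have /andP[] : (x ^+ 2 < 1) && (y ^+ 2 < 1).
    by apply/andP; split; apply: le_lt_trans h; rewrite ?lerDl ?lerDr sqr_ge0.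
  by move=> x1 y1; split; apply/andP; split; nra.
rewrite /leb2 product_measure1E//= lebesgue_measure_itv/=.
by case: ifP => _; rewrite ?mule0// -EFinD -EFinM ltry.
Qed.

Let disc1_gt0 : (0 < leb2 R (disc 1))%E.
Proof.
apply: (@lt_le_trans _ _ (leb2 R (`]0%R, (2^-1)%R[ `*` `]0%R, (2^-1)%R[))).
  rewrite /leb2 product_measure1E//= lebesgue_measure_itv/= lte_fin invr_gt0 ltr0n/=.
  by rewrite -EFinD subr0 -EFinM lte_fin mulr_gt0// invr_gt0.
apply: le_measure; rewrite ?inE//; [exact: measurableX|exact: measurable_disc|].
move=> [x y] /=; rewrite !in_itv/= => -[/andP[x0 x1] /andP[y0 y1]].
rewrite /disc /dot2/=.
have xx : x * x <= 2^-1 * 2^-1 by rewrite ler_pM// ltW.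
have yy : y * y <= 2^-1 * 2^-1 by rewrite ler_pM// ltW.
lra.
Qed.

Let area1_gt0 : 0 < area1.
Proof. by rewrite fine_gt0// disc1_gt0. Qed.

Let area_disc v : 0 <= v -> leb2 R (disc v) = (area1 * v)%:E.
Proof.
rewrite le_eqVlt => /predU1P[<-|v0].
  rewrite mulr0 (_ : disc 0 = set0) ?measure0// -subset0 => z /=.
  by rewrite /disc/= ltNge dot2_ge0.
pose r := (Num.sqrt v)^-1.
have r0 : 0 < r by rewrite invr_gt0 sqrtr_gt0.
have m1 : measurable (disc 1) by exact: measurable_disc.
have mv : measurable (disc v) by exact: measurable_disc.
transitivity (\int[leb2 R]_z (\1_(disc v) z)%:E)%E; first by rewrite integral_indic// setIT.
transitivity (\int[leb2 R]_z (fun y : plane R => (\1_(disc 1) y)%:E) (r * z.1, r * z.2)%R)%E.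
  apply: eq_integral => z _; congr EFin; rewrite !indicE; congr (nat_of_bool _)%:R.
  rewrite /disc; apply/idP/idP; rewrite !inE /= /dot2/=.
    move=> h; have -> : r * z.1 * (r * z.1) + r * z.2 * (r * z.2) = (z.1 * z.1 + z.2 * z.2) * r ^+ 2 by ring.
    by rewrite exprVn sqr_sqrtr ?ltW// ltr_pdivrMr// mul1r.
  have -> : r * z.1 * (r * z.1) + r * z.2 * (r * z.2) = (z.1 * z.1 + z.2 * z.2) * r ^+ 2 by ring.
  by rewrite exprVn sqr_sqrtr ?ltW// ltr_pdivrMr// mul1r.
rewrite (@leb2_scale R r (fun y : plane R => (\1_(disc 1) y)%:E) r0).
- rewrite integral_indic// setIT invrK sqr_sqrtr ?(ltW v0)// mulrC EFinM fineK//.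
  by rewrite ge0_fin_numE ?disc1_lty// measure_ge0.
- exact/measurable_EFinP/measurable_indic.
- by move=> y; rewrite lee_fin indicE.
Qed.

Let e2E z : e2 z = expR (- (dot2 z z / (2 * s))). Proof. by []. Qed.

Let I v := (\int[leb2 R]_(z in disc v) (e2 z)%:E)%E.

Let s20 : 0 < 2 * s. Proof. by rewrite mulr_gt0. Qed.

(** On the annulus the kernel lies between its values on the two boundary circles. *)
Let I_annulus t u : 0 <= t -> t <= u -> exists2 d : R, I u = (I t + d%:E)%E &
  area1 * (u - t) * expR (- (u / (2 * s))) <= d /\
  d <= area1 * (u - t) * expR (- (t / (2 * s))).
Proof.
move=> t0 tu.
have mt := measurable_disc t; have mu := measurable_disc u.
have sub : disc t `<=` disc u by move=> z /lt_le_trans; exact.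
have mN : measurable (disc u `\` disc t) by exact: measurableD.
have me D : measurable_fun D (fun z : plane R => (e2 z)%:E).
  by apply/measurable_EFinP; apply: measurable_funTS; exact: measurable_gker0.
have areaN : leb2 R (disc u `\` disc t) = (area1 * (u - t))%:E.
  have u0 : 0 <= u by exact: le_trans tu.
  rewrite measureD//=; last by rewrite area_disc// ltry.
  by rewrite setIidr// !area_disc// -EFinB mulrBr.
have IN : I u = (I t + \int[leb2 R]_(z in disc u `\` disc t) (e2 z)%:E)%E.
  have -> : I u = (\int[leb2 R]_(z in disc t `|` (disc u `\` disc t)) (e2 z)%:E)%E.
    by rewrite setDE setUIr setUv setIT (setUidr sub).
  rewrite (@ge0_integral_setU _ _ _ (leb2 R) _ _ mt mN _ (me _))//.
    by move=> z _; rewrite lee_fin expR_ge0.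
  by apply/disj_setPS => z [] /= ? [].
have up : (\int[leb2 R]_(z in disc u `\` disc t) (e2 z)%:E <=
    (area1 * (u - t) * expR (- (t / (2 * s))))%:E)%E.
  rewrite [leRHS](_ : _ = \int[leb2 R]_(z in disc u `\` disc t) (expR (- (t / (2 * s))))%:E)%E.
    apply: ge0_le_integral => //.
    - by move=> z _; rewrite lee_fin expR_ge0.
    - move=> z [_ /negP]; rewrite /disc/= -leNgt => h.
      by rewrite lee_fin ler_expR lerN2 ler_pM2r// invr_gt0.
  by rewrite integral_cst//= areaN -EFinM mulrC.
have lo : ((area1 * (u - t) * expR (- (u / (2 * s))))%:E <=
    \int[leb2 R]_(z in disc u `\` disc t) (e2 z)%:E)%E.
  rewrite [leLHS](_ : _ = \int[leb2 R]_(z in disc u `\` disc t) (expR (- (u / (2 * s))))%:E)%E.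
    apply: ge0_le_integral => //.
    - move=> z [h _]; rewrite lee_fin ler_expR lerN2 ler_pM2r ?invr_gt0//.
      exact: ltW.
  by rewrite integral_cst//= areaN -EFinM mulrC.
have fN : (\int[leb2 R]_(z in disc u `\` disc t) (e2 z)%:E)%E \is a fin_num.
  rewrite ge0_fin_numE; first by rewrite (le_lt_trans up)// ltry.
  by apply: integral_ge0 => z _; rewrite lee_fin expR_ge0.
exists (fine (\int[leb2 R]_(z in disc u `\` disc t) (e2 z)%:E)%E); first by rewrite fineK.
by split; rewrite -lee_fin fineK.
Qed.

Let I0 : I 0 = 0%E.
Proof.
rewrite /I (_ : disc 0 = set0) ?integral_set0// -subset0 => z /=.
by rewrite /disc/= ltNge dot2_ge0.
Qed.

Definition disc_cst := area1 * (2 * s).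

Lemma disc_cst_gt0 : 0 < disc_cst.
Proof. by rewrite mulr_gt0. Qed.

(** The closed form expected for [I]: it vanishes at 0 and has derivative
    [area1 * expR (- (v / (2 * s)))]. *)
Let J v := disc_cst * (1 - expR (- (v / (2 * s)))).

Let expR_gap (x : R) : 0 <= x -> expR (- x) <= 1. Proof. by move=> x0; rewrite -expR0 ler_expR oppr_le0. Qed.

(** The same two bounds as for [I], now from [1 + x <= expR x] at plus and minus the rescaled
    step. *)
Let J_annulus t u : 0 <= t -> t <= u ->
  area1 * (u - t) * expR (- (u / (2 * s))) <= J u - J t /\
  J u - J t <= area1 * (u - t) * expR (- (t / (2 * s))).
Proof.
move=> t0 tu; set x := (u - t) / (2 * s).
have Ju : J u - J t = disc_cst * (expR (- (u / (2 * s))) * (expR x - 1)).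
  rewrite mulrBr -expRD /J mulr1.
  have -> : - (u / (2 * s)) + x = - (t / (2 * s)) by rewrite /x; field; rewrite gt_eqF.
  by ring.
have Jt : J u - J t = disc_cst * (expR (- (t / (2 * s))) * (1 - expR (- x))).
  rewrite mulrBr -expRD /J mulr1.
  have -> : - (t / (2 * s)) - x = - (u / (2 * s)) by rewrite /x; field; rewrite gt_eqF.
  by ring.
have ax : area1 * (u - t) = disc_cst * x by rewrite /disc_cst /x; field; rewrite gt_eqF.
have k0 := ltW disc_cst_gt0.
split.
  rewrite Ju ax -mulrA; apply: ler_wpM2l => //; rewrite mulrC.
  apply: ler_wpM2l; first exact: expR_ge0.
  by rewrite lerBrDl expR_ge1Dx.
rewrite Jt ax -mulrA; apply: ler_wpM2l => //; rewrite [leRHS]mulrC.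
apply: ler_wpM2l; first exact: expR_ge0.
by rewrite lerBlDl -lerBlDr expR_ge1Dx.
Qed.

Let I_fin v : 0 <= v -> I v \is a fin_num.
Proof. by move=> v0; have [d -> _] := I_annulus (lexx 0) v0; rewrite I0 add0e. Qed.

Let gap t u : 0 <= t -> t <= u ->
  area1 * (u - t) * expR (- (t / (2 * s))) - area1 * (u - t) * expR (- (u / (2 * s))) <=
  area1 / (2 * s) * (u - t) ^+ 2.
Proof.
move=> t0 tu; rewrite -mulrBr.
have -> : area1 / (2 * s) * (u - t) ^+ 2 = area1 * (u - t) * ((u - t) / (2 * s)).
  by field; rewrite gt_eqF.
apply: ler_wpM2l; first by rewrite mulr_ge0 ?subr_ge0// ltW.
have -> : - (u / (2 * s)) = - (t / (2 * s)) - (u - t) / (2 * s) by field; rewrite gt_eqF.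
rewrite expRD -[X in X - _]mulr1 -mulrBr.
have h1 : expR (- (t / (2 * s))) <= 1 by apply: expR_gap; rewrite divr_ge0// ltW.
have h2 : 1 - expR (- ((u - t) / (2 * s))) <= (u - t) / (2 * s).
  by rewrite lerBlDl -lerBlDr expR_ge1Dx.
apply: (le_trans _ h2); rewrite ler_piMl// subr_ge0; apply: expR_gap.
by rewrite divr_ge0 ?subr_ge0// ltW.
Qed.

(** [I] and [J] have increments between the same bounds, which by [gap] differ quadratically in the
    step. Hence [subdivision_le], applied to both differences, forces equality without
    differentiating [I]. *)
Lemma integral_disc v : 0 <= v -> I v = (J v)%:E.
Proof.
move=> v0; rewrite -[LHS]fineK ?I_fin//; congr EFin.
have Id t u : 0 <= t -> t <= u ->
    area1 * (u - t) * expR (- (u / (2 * s))) <= fine (I u) - fine (I t) /\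
    fine (I u) - fine (I t) <= area1 * (u - t) * expR (- (t / (2 * s))).
  move=> t0 tu; have [d -> dd] := I_annulus t0 tu.
  by rewrite fineD ?I_fin//= addrAC subrr add0r.
have K0 : 0 <= area1 / (2 * s) by rewrite divr_ge0 ?ltW.
have J00 : J 0 = 0 by rewrite /J mul0r oppr0 expR0 subrr mulr0.
have up : ((fine (I 0) - J 0)%:E <= (fine (I v) - J v)%:E)%E.
  apply: (@subdivision_le R (fun t => (fine (I t) - J t)%:E) 0 v 0 (area1 / (2 * s))) => //.
  move=> t u t0 tu uv _; rewrite -EFinD lee_fin.
  have [i1 i2] := Id _ _ t0 tu; have [j1 j2] := J_annulus t0 tu; have := gap t0 tu.
  lra.
have lo : ((J 0 - fine (I 0))%:E <= (J v - fine (I v))%:E)%E.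
  apply: (@subdivision_le R (fun t => (J t - fine (I t))%:E) 0 v 0 (area1 / (2 * s))) => //.
  move=> t u t0 tu uv _; rewrite -EFinD lee_fin.
  have [i1 i2] := Id _ _ t0 tu; have [j1 j2] := J_annulus t0 tu; have := gap t0 tu.
  lra.
move: up lo; rewrite !lee_fin J00 I0/= subr0 => h1 h2; apply/eqP.
by rewrite eq_le -subr_ge0 h2 -subr_ge0 h1.
Qed.

(** For [a < c] the super-level set is the disc of squared radius 2 s ln(c / a), where
    [integral_disc] gives a multiple of c (1 - a / c); otherwise it is empty. *)
Lemma integral_super_level (a c : R) : 0 < a -> 0 <= c ->
  (\int[leb2 R]_z (if (a < c * e2 z)%R then c * e2 z else 0)%:E =
   (disc_cst * Num.max (c - a) 0)%:E)%E.
Proof.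
move=> a0 c0.
have e1 z : e2 z <= 1 by apply: expR_gap; rewrite divr_ge0 ?dot2_ge0// ltW.
have [ca|ac] := leP c a.
  rewrite max_r ?subr_le0// mulr0 integral0_eq// => z _.
  by rewrite ltNge (le_trans _ ca)// ler_piMr.
rewrite max_l ?subr_ge0 ?(ltW ac)//.
have c1 : 0 < c by exact: lt_trans ac.
pose v := 2 * s * ln (c / a).
have v0 : 0 <= v by rewrite mulr_ge0 ?(ltW s20)// ln_ge0// ler_pdivlMr// mul1r ltW.
transitivity (\int[leb2 R]_(z in disc v) (c%:E * (e2 z)%:E))%E.
  rewrite [RHS]integral_mkcond; apply: eq_integral => z _.
  have -> : (a < c * e2 z)%R = (z \in disc v).
    rewrite mulrC -ltr_pdivrMr// e2E.
    have -> : a / c = expR (- ln (c / a)).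
      by rewrite expRN lnK ?posrE ?divr_gt0// invf_div.
    rewrite ltr_expR ltrN2 ltr_pdivrMr// [ln _ * _]mulrC.
    by apply/idP/idP => [h|]; rewrite inE.
  by rewrite /patch; case: ifP.
rewrite ge0_integralZl//.
- rewrite -/(I v) integral_disc// -EFinM /J /v; congr EFin.
  have -> : expR (- (2 * s * ln (c / a) / (2 * s))) = a / c.
    have -> : 2 * s * ln (c / a) / (2 * s) = ln (c / a) by field; rewrite gt_eqF.
    by rewrite expRN lnK ?posrE ?divr_gt0// invf_div.
  by field; rewrite gt_eqF.
- exact: measurable_disc.
- apply/measurable_EFinP; apply: measurable_funTS; exact: measurable_gker0.
- by move=> z _; rewrite lee_fin expR_ge0.
Qed.

End disc.

(** * The hinge inequality for finitely many points *)

Section finite_hinge.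
Context (R : realType) (s : R) (s0 : 0 < s).
Local Notation X4 := (plane R * plane R)%type.
Variables (I : Type) (r : seq I) (w : I -> R) (p q : I -> plane R) (D : R).
Hypothesis w0 : forall i, 0 <= w i.
Hypothesis pq : forall i j,
  dot2 (q i - q j) (q i - q j) <= dot2 (p i - p j) (p i - p j).
Hypothesis pD : forall i j, dot2 (p i - p j) (p i - p j) <= D.
Hypothesis D0 : 0 <= D.
Variable a : R.
Hypothesis a0 : 0 < a.

Local Notation mix2 := (gmix (@dot2 R) s r w).
Local Notation mix4 := (gmix (@dot4 R) s r w).

Definition cut (u : R) : R := if a < u then u else 0.

Let cut_ge0 u : 0 <= cut u.
Proof. by rewrite /cut; case: ltP => // /ltW; exact/le_trans/ltW. Qed.

Let measurable_cut : measurable_fun setT cut.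
Proof.
apply: nondecreasing_measurable => // u v uv; rewrite /cut.
case: ltP => au; case: ltP => av //.
- by have := lt_le_trans au (le_trans uv av); rewrite ltxx.
- by rewrite (le_trans (ltW a0))// ltW.
Qed.

Let satur_le_cut n u : 0 <= n -> 0 <= u -> u * satur a n u <= cut u.
Proof.
move=> n0 u0; rewrite /cut; case: ltP => au; first by rewrite ler_piMr// satur_le1.
by rewrite /satur max_r ?subr_le0// mulr0 addr0 invr1 subrr mulr0.
Qed.

Let satur_ndecr_n u : {homo (fun n => satur a n%:R u) : n m / (n <= m)%N >-> n <= m}.
Proof.
move=> n m nm; rewrite /satur lerB// lef_pV2 ?posrE.
- by rewrite lerD2l ler_wpM2r ?ler_nat// le_max lexx orbT.
- by rewrite ltr_pwDl// mulr_ge0// le_max lexx orbT.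
- by rewrite ltr_pwDl// mulr_ge0// le_max lexx orbT.
Qed.

Let cvg_satur u : u * satur a n%:R u @[n --> \oo] --> cut u.
Proof.
rewrite /cut; case: ltP => au; last first.
  rewrite (_ : (fun n : nat => _) = cst 0); first exact: cvg_cst.
  apply/funext => n.
  by rewrite /satur max_r ?subr_le0// mulr0 addr0 invr1 subrr mulr0.
rewrite -[X in _ --> X]mulr1; apply: cvgMr.
rewrite -[X in _ --> X]subr0; apply: cvgB; first exact: cvg_cst.
rewrite max_l ?subr_ge0 ?(ltW au)//.
have ua : 0 < u - a by rewrite subr_gt0.
apply/cvgrPdist_le => e e0; near=> n.
rewrite sub0r normrN ger0_norm; last by rewrite invr_ge0 addr_ge0// mulr_ge0// ltW.
rewrite -[leRHS]invrK lef_pV2 ?posrE ?invr_gt0//; last by rewrite ltr_pwDl// mulr_ge0// ltW.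
rewrite -lerBlDl -ler_pdivrMr//.
by near: n; exact: nbhs_infty_ger.
Unshelve. all: by end_near. Qed.

(** Monotone convergence: the saturations increase with [n] to the indicator of values above [a]. *)
Let energy_cvg (P : I -> X4) :
  energy s r w a n%:R P @[n --> \oo] --> (\int[leb2 R \x leb2 R]_x (cut (mix4 P x))%:E)%E.
Proof.
have mf := measurable_gmix4 s r w P.
have := @cvg_monotone_convergence _ _ _ (leb2 R \x leb2 R)%E setT measurableT
  (fun n x => (mix4 P x * satur a n%:R (mix4 P x))%:E).
rewrite (_ : (\int[_]_x (fun x0 => limn _) x)%E =
  (\int[leb2 R \x leb2 R]_x (cut (mix4 P x))%:E)%E); last first.
  apply: eq_integral => x _; apply/cvg_lim => //.
  by apply: cvg_EFin; [near=> n|exact: cvg_satur].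
apply.
- move=> n; apply/measurable_EFinP; apply: measurable_funM => //.
  exact: (measurableT_comp (measurable_satur a (ler0n _ n)) mf).
- by move=> n x _; rewrite lee_fin mulr_ge0 ?satur_ge0// gmix4_ge0.
- by move=> x _ n m nm; rewrite lee_fin ler_wpM2l ?gmix4_ge0// satur_ndecr_n.
Unshelve. all: by end_near. Qed.

(** At the far end every smoothed energy is already below the integral of [cut], so only the near
    end requires a limit. *)
Let cut_rotation :
  (\int[leb2 R \x leb2 R]_x (cut (mix4 (fun i => (p i, 0%R)) x))%:E <=
   \int[leb2 R \x leb2 R]_x (cut (mix4 (fun i => (0%R, q i)) x))%:E)%E.
Proof.
have h := @energy_cvg (fun i => (p i, 0)).
rewrite -(cvg_lim _ h)//; apply: lime_le; first by apply/cvg_ex; eexists; exact: h.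
near=> n; apply: (le_trans (energy_rotation s0 r w0 pq pD D0 a (ler0n _ n))).
have mf := measurable_gmix4 s r w (fun i => (0, q i)).
apply: ge0_le_integral => //.
- by move=> x _; rewrite lee_fin mulr_ge0 ?satur_ge0// gmix4_ge0.
- apply/measurable_EFinP; apply: measurable_funM => //.
  exact: (measurableT_comp (measurable_satur a (ler0n _ n)) mf).
- apply/measurable_EFinP; exact: (measurableT_comp measurable_cut mf).
- by move=> x _; rewrite lee_fin satur_le_cut// gmix4_ge0.
Unshelve. all: by end_near. Qed.

Let mix4l x y : mix4 (fun i => (p i, 0)) (x, y) = mix2 p x * gker (@dot2 R) s y.
Proof. by rewrite /gmix mulr_suml; apply: eq_bigr => i _; rewrite gker4E/= subr0 mulrA. Qed.

Let mix4r x y : mix4 (fun i => (0, q i)) (x, y) = mix2 q y * gker (@dot2 R) s x.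
Proof.
rewrite /gmix mulr_suml; apply: eq_bigr => i _; rewrite gker4E/= subr0.
by rewrite mulrAC mulrA.
Qed.

Let mix2_ge0 (P : I -> plane R) x : 0 <= mix2 P x.
Proof. by apply: sumr_ge0 => i _; rewrite mulr_ge0// expR_ge0. Qed.

Lemma measurable_gmix2 (P : I -> plane R) : measurable_fun setT (mix2 P).
Proof.
by apply: measurable_sum => i; apply: measurable_funM => //; exact: measurable_gker2.
Qed.

Let fubini_cut (P : I -> plane R) :
  (\int[leb2 R]_x \int[leb2 R]_y (cut (mix2 P x * gker (@dot2 R) s y))%:E =
   (disc_cst s)%:E * \int[leb2 R]_x (Num.max (mix2 P x - a) 0)%:E)%E.
Proof.
rewrite -ge0_integralZl//.
- by apply: eq_integral => x _; rewrite integral_super_level// EFinM.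
- apply/measurable_EFinP; apply: measurable_maxr => //.
  by apply: measurable_funB => //; exact: measurable_gmix2.
- by move=> x _; rewrite lee_fin le_max lexx orbT.
- by rewrite lee_fin ltW// disc_cst_gt0.
Qed.

Lemma finite_hinge_le :
  (\int[leb2 R]_x (Num.max (mix2 p x - a) 0)%:E <=
   \int[leb2 R]_x (Num.max (mix2 q x - a) 0)%:E)%E.
Proof.
have mc P : measurable_fun setT (fun x : X4 => (cut (mix4 P x))%:E).
  by apply/measurable_EFinP; exact: (measurableT_comp measurable_cut (measurable_gmix4 s r w P)).
have c0 P (x : X4) : (0 <= (cut (mix4 P x))%:E)%E by rewrite lee_fin cut_ge0.
have := cut_rotation.
(* The common Gaussian factor sits in the second plane on the left and in the first plane on the
   right, hence the opposite orders of integration. *)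
rewrite (@fubini_tonelli1 _ _ _ _ _ (leb2 R) (leb2 R) _ (mc _) (c0 _)).
rewrite (@fubini_tonelli2 _ _ _ _ _ (leb2 R) (leb2 R) _ (mc _) (c0 _)).
rewrite /fubini_F /fubini_G.
under eq_integral do under eq_integral do rewrite mix4l.
under [leRHS]eq_integral do under eq_integral do rewrite mix4r.
by rewrite !fubini_cut lee_pmul2l// lte_fin disc_cst_gt0.
Qed.

End finite_hinge.

(** * Finitely valued approximations and Lipschitz maps of the plane *)

Import HBSimple.

Section finite_valued.
Context (R : realType).

(** [r] may contain points that are not attained; as it has no repetitions, the fibres over its
    members form a measurable partition. *)
Definition finite_valued_on (r : seq (plane R)) (f : plane R -> plane R) : Prop :=
  [/\ uniq r, forall y, f y \in r & forall k, measurable (f @^-1` [set k])].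

Lemma finite_valuedE r f (F : plane R -> R) y : finite_valued_on r f ->
  F (f y) = \sum_(k <- r) F k * \1_(f @^-1` [set k]) y.
Proof.
move=> [ur fr _]; rewrite (bigD1_seq (f y))//= indicE mem_set//= mulr1.
rewrite big1 ?addr0// => k kfy; rewrite indicE memNset ?mulr0//=.
by move=> e; rewrite e eqxx in kfy.
Qed.

Lemma measurable_finite_valued r f (F : plane R -> R) : finite_valued_on r f ->
  measurable_fun setT (F \o f).
Proof.
move=> rf; rewrite (_ : F \o f = (fun y => \sum_(k <- r) F k * \1_(f @^-1` [set k]) y)); last first.
  by apply/funext => y /=; exact: finite_valuedE.
apply: measurable_sum => k; apply: measurable_funM => //.
by apply: measurable_indic; case: rf.
Qed.

Lemma integral_finite_valued r f (F : plane R -> R) (mu : probability (plane R) R) :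
  finite_valued_on r f -> (forall k, 0 <= F k) ->
  (\int[mu]_y (F (f y))%:E = (\sum_(k <- r) F k * fine (mu (f @^-1` [set k])))%:E)%E.
Proof.
move=> rf F0; have [_ _ mf] := rf.
under eq_integral do rewrite (finite_valuedE _ _ rf) -sumEFin.
rewrite ge0_integral_sum//; last 2 first.
- move=> k; apply/measurable_EFinP; apply: measurable_funM => //; exact: measurable_indic.
- by move=> k y _; rewrite lee_fin mulr_ge0// indicE.
rewrite -sumEFin; apply: eq_bigr => k _.
under eq_integral do rewrite EFinM.
rewrite ge0_integralZl//.
- by rewrite integral_indic// setIT EFinM fineK// fin_num_measure.
- by apply/measurable_EFinP; exact: measurable_indic.
- by rewrite lee_fin.
Qed.

(** Each coordinate is approximated by simple functions; the pair takes values in the finite product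
    of their ranges. *)
Lemma finite_valued_approx :
  exists2 f : nat -> plane R -> plane R,
    forall n, exists r, finite_valued_on r (f n) &
    forall y, (f n y).1 @[n --> \oo] --> y.1 /\ (f n y).2 @[n --> \oo] --> y.2.
Proof.
have [g1 h1] : exists g : {sfun (plane R) >-> R}^nat,
    forall x : plane R, setT x -> EFin \o g ^~ x @ \oo --> (x.1 : R)%:E.
  by apply: (@approximation_sfun _ _ _ (fun x : plane R => (x.1 : R)%:E)) => //; exact/measurable_EFinP.
have [g2 h2] : exists g : {sfun (plane R) >-> R}^nat,
    forall x : plane R, setT x -> EFin \o g ^~ x @ \oo --> (x.2 : R)%:E.
  by apply: (@approximation_sfun _ _ _ (fun x : plane R => (x.2 : R)%:E)) => //; exact/measurable_EFinP.
exists (fun n y => (g1 n y, g2 n y)); last first.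
  move=> y; split.
    by have /fine_cvgP[] := h1 y I.
  by have /fine_cvgP[] := h2 y I.
move=> n.
have /finite_seqP[r rE] : finite_set (range (g1 n) `*` range (g2 n)).
  by apply: finite_setX.
exists (undup r); split; first exact: undup_uniq.
- move=> y; rewrite mem_undup.
  by have : [set` r] (g1 n y, g2 n y) by rewrite -rE; split; exists y.
- move=> [k1 k2].
  rewrite (_ : _ @^-1` _ = (g1 n @^-1` [set k1]) `&` (g2 n @^-1` [set k2])).
    by apply: measurableI.
  by apply/seteqP; split => y /= [-> ->].
Qed.

End finite_valued.

Section lipschitz_plane.
Context (R : realType) (T : plane R -> plane R) (T_lip : lipschitz1_norm2 T).

Lemma norm2_sqr (x : plane R) : norm2 x ^+ 2 = dot2 x x.
Proof. by rewrite /norm2 sqr_sqrtr ?addr_ge0 ?sqr_ge0// /dot2 -!expr2. Qed.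

Lemma lipschitz_dot2 x y : dot2 (T x - T y) (T x - T y) <= dot2 (x - y) (x - y).
Proof. by rewrite -!norm2_sqr ler_sqr ?nnegrE ?sqrtr_ge0//; exact: T_lip. Qed.

(** A coordinate is at most the Euclidean norm, itself at most the sum of the absolute coordinates;
    this turns the Lipschitz bound into coordinatewise convergence. *)
Let dot2_bound (x y z : plane R) : dot2 x x <= dot2 (y - z) (y - z) ->
  `|x.1| <= `|y.1 - z.1| + `|y.2 - z.2| /\ `|x.2| <= `|y.1 - z.1| + `|y.2 - z.2|.
Proof.
set A := `|y.1 - z.1|; set B := `|y.2 - z.2|.
have -> : dot2 (y - z) (y - z) = A ^+ 2 + B ^+ 2.
  by rewrite /A /B !real_normK ?num_real.
move=> h.
have A0 : 0 <= A by exact: normr_ge0.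
have B0 : 0 <= B by exact: normr_ge0.
have AB : A ^+ 2 + B ^+ 2 <= (A + B) ^+ 2 by have := mulr_ge0 A0 B0; nra.
have H := le_trans h AB.
have h1 : x.1 ^+ 2 <= (A + B) ^+ 2.
  by apply: le_trans H; rewrite /dot2 -!expr2 lerDl sqr_ge0.
have h2 : x.2 ^+ 2 <= (A + B) ^+ 2.
  by apply: le_trans H; rewrite /dot2 -!expr2 lerDr sqr_ge0.
split.
- by rewrite -ler_sqr ?nnegrE ?addr_ge0// real_normK ?num_real.
- by rewrite -ler_sqr ?nnegrE ?addr_ge0// real_normK ?num_real.
Qed.

Lemma lipschitz_cvg (f : nat -> plane R) (y : plane R) :
  (f n).1 @[n --> \oo] --> y.1 -> (f n).2 @[n --> \oo] --> y.2 ->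
  (T (f n)).1 @[n --> \oo] --> (T y).1 /\ (T (f n)).2 @[n --> \oo] --> (T y).2.
Proof.
move=> h1 h2.
have h : (`|y.1 - (f n).1| + `|y.2 - (f n).2|) @[n --> \oo] --> (0 : R).
  rewrite -[X in _ --> X]addr0 -[in X in _ --> X](normr0 R).
  rewrite -{1}(subrr (y.1 : R)) -(subrr (y.2 : R)).
  by apply: cvgD; apply: cvg_norm; apply: cvgB => //; exact: cvg_cst.
have bd n := @dot2_bound (T y - T (f n)) y (f n) (lipschitz_dot2 _ _).
split; apply/cvgrPdist_le => e e0.
  move/cvgrPdist_le : h => /(_ e e0); apply: filterS => n.
  by rewrite sub0r normrN ger0_norm ?addr_ge0//; apply: le_trans; case: (bd n).
move/cvgrPdist_le : h => /(_ e e0); apply: filterS => n.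
by rewrite sub0r normrN ger0_norm ?addr_ge0//; apply: le_trans; case: (bd n).
Qed.

(** Any map composed with a finitely valued [f n] is measurable, and continuity makes these
    compositions converge pointwise to [T]. *)
Lemma lipschitz_measurable : measurable_fun setT T.
Proof.
have [f fv fc] := finite_valued_approx R.
apply/measurable_fun_pairP; split.
  apply: (@measurable_fun_cvg _ _ _ _ (fun n y => (T (f n y)).1)).
    by move=> n; have [r rf] := fv n; exact: (measurable_finite_valued (fun z => (T z).1) rf).
  by move=> y _; have [c1 c2] := fc y; have [] := lipschitz_cvg c1 c2.
apply: (@measurable_fun_cvg _ _ _ _ (fun n y => (T (f n y)).2)).
  by move=> n; have [r rf] := fv n; exact: (measurable_finite_valued (fun z => (T z).2) rf).
by move=> y _; have [c1 c2] := fc y; have [] := lipschitz_cvg c1 c2.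
Qed.

End lipschitz_plane.

(** * Gaussian potentials of general probability measures *)

Section potential.
Context (R : realType) (s : R) (s0 : 0 < s) (mu : probability (plane R) R).
Local Notation e2 := (gker (@dot2 R) s).

(** Up to the factor (2 pi s)^-1, the Gaussian convolution of the push-forward of [mu] by [p]; [id]
    gives [mu] itself. *)
Definition potential (p : plane R -> plane R) (x : plane R) : R :=
  fine (\int[mu]_y (e2 (x - p y))%:E).

Lemma gker2_le1 z : e2 z <= 1.
Proof. by rewrite -expR0 ler_expR oppr_le0 divr_ge0 ?dot2_ge0// mulr_ge0// ltW. Qed.

Section one_map.
Variable p : plane R -> plane R.
Hypothesis mp : measurable_fun setT p.

Let measurable_joint :
  measurable_fun setT (fun z : plane R * plane R => (e2 (z.1 - p z.2))%:E).
Proof.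
apply/measurable_EFinP.
apply: (measurableT_comp (measurable_gker0 s)
  (g := fun z : plane R * plane R => z.1 - p z.2)).
have m1 := @measurable_fst _ _ (plane R) (plane R).
have m2 := measurableT_comp mp (@measurable_snd _ _ (plane R) (plane R)).
apply: (measurable_fun_pair (f := fun z : plane R * plane R => ((z.1).1 : R) - (p z.2).1)
  (g := fun z : plane R * plane R => ((z.1).2 : R) - (p z.2).2)).
  apply: measurable_funB; first exact: (measurableT_comp measurable_fst m1).
  exact: (measurableT_comp measurable_fst m2).
apply: measurable_funB; first exact: (measurableT_comp measurable_snd m1).
exact: (measurableT_comp measurable_snd m2).
Qed.

Let joint_ge0 (z : plane R * plane R) : (0 <= (e2 (z.1 - p z.2))%:E)%E.
Proof. by rewrite lee_fin expR_ge0. Qed.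

Lemma measurable_section x : measurable_fun setT (fun y => (e2 (x - p y))%:E).
Proof. exact: (measurable_fun_pair2 x measurable_joint). Qed.

Lemma integral_potential_ge0 x : (0 <= \int[mu]_y (e2 (x - p y))%:E)%E.
Proof. by apply: integral_ge0 => y _; rewrite lee_fin expR_ge0. Qed.

Lemma integral_potential_le1 x : (\int[mu]_y (e2 (x - p y))%:E <= 1)%E.
Proof.
apply: (@le_trans _ _ (\int[mu]_y (cst 1%:E y))%E).
  apply: ge0_le_integral => //.
  - by move=> y _; rewrite lee_fin expR_ge0.
  - exact: (measurable_section x).
  by move=> y _; rewrite lee_fin gker2_le1.
by rewrite integral_cst//= mul1e probability_setT.
Qed.

Lemma potentialE x : (potential p x)%:E = (\int[mu]_y (e2 (x - p y))%:E)%E.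
Proof.
rewrite fineK// ge0_fin_numE ?integral_potential_ge0//.
by rewrite (le_lt_trans (integral_potential_le1 x))// ltry.
Qed.

Lemma potential_ge0 x : 0 <= potential p x.
Proof. by rewrite -lee_fin potentialE integral_potential_ge0. Qed.

Lemma potential_le1 x : potential p x <= 1.
Proof. by rewrite -lee_fin potentialE integral_potential_le1. Qed.

Lemma measurable_potential : measurable_fun setT (potential p).
Proof.
apply/measurable_EFinP.
rewrite (_ : EFin \o potential p = fubini_F mu (fun z : plane R * plane R => (e2 (z.1 - p z.2))%:E)).
  exact: (measurable_fun_fubini_tonelli_F (m2 := mu) _ measurable_joint joint_ge0).
by apply/funext => x /=; rewrite potentialE.
Qed.

Lemma integral_potential : (\int[leb2 R]_x (potential p x)%:E = gauss_mass s)%E.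
Proof.
under eq_integral do rewrite potentialE.
have := @fubini_tonelli _ _ _ _ _ (leb2 R) mu _ measurable_joint joint_ge0.
rewrite /fubini_F /fubini_G /= => ->.
have inner y : (\int[leb2 R]_x (e2 (x - p y))%:E = gauss_mass s)%E.
  apply: (@leb2_translate R (- p y) (fun x => (e2 x)%:E)).
    by apply/measurable_EFinP; exact: measurable_gker0.
  by move=> x; rewrite lee_fin expR_ge0.
under eq_integral do rewrite inner.
by rewrite integral_cst//= probability_setT mule1.
Qed.

(** From max(t - a, 0) + min(t, a) = t. As the total does not depend on [p], raising the hinge
    integral amounts to lowering the truncated one. *)
Lemma integral_potential_hinge (a : R) : 0 < a ->
  (\int[leb2 R]_x (Num.max (potential p x - a) 0)%:E +
   \int[leb2 R]_x (Num.min (potential p x) a)%:E = gauss_mass s)%E.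
Proof.
move=> a0; have mf := measurable_potential.
rewrite -integral_potential -ge0_integralD//.
- apply: eq_integral => x _; rewrite -EFinD; congr EFin.
  have [h|h] := leP (potential p x) a.
    by rewrite max_r ?subr_le0// add0r.
  by rewrite max_l ?subr_ge0 ?(ltW h)// subrK.
- by move=> x _; rewrite lee_fin le_max lexx orbT.
- apply/measurable_EFinP; apply: measurable_maxr => //.
  exact: measurable_funB.
- by move=> x _; rewrite lee_fin le_min potential_ge0 ltW.
- by apply/measurable_EFinP; exact: measurable_minr.
Qed.

End one_map.

Lemma cvg_gker2 (u : nat -> plane R) (v : plane R) :
  (u n).1 @[n --> \oo] --> v.1 -> (u n).2 @[n --> \oo] --> v.2 ->
  e2 (u n) @[n --> \oo] --> e2 v.
Proof.
move=> h1 h2.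
have h : (- (dot2 (u n) (u n) / (2 * s))) @[n --> \oo] --> - (dot2 v v / (2 * s)).
  by apply: cvgN; apply: cvgMl; apply: cvgD; exact: cvgM.
exact: (cvg_comp _ _ h (@continuous_expR R _)).
Qed.

Lemma potential_cvg (p_ : nat -> plane R -> plane R) (p : plane R -> plane R) x :
  (forall n, measurable_fun setT (p_ n)) -> measurable_fun setT p ->
  (forall y, (p_ n y).1 @[n --> \oo] --> (p y).1 /\ (p_ n y).2 @[n --> \oo] --> (p y).2) ->
  potential (p_ n) x @[n --> \oo] --> potential p x.
Proof.
move=> mp_ mp cp.
have [_ _ h] : [/\ mu.-integrable setT (fun y => (e2 (x - p y))%:E),
    [sequence (\int[mu]_y `|(e2 (x - p_ n y))%:E - (e2 (x - p y))%:E|)%E]_n @ \oo --> 0%E &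
    [sequence (\int[mu]_y (e2 (x - p_ n y))%:E)%E]_n @ \oo --> (\int[mu]_y (e2 (x - p y))%:E)%E].
  apply: (@dominated_convergence _ _ _ mu setT measurableT
    (fun n y => (e2 (x - p_ n y))%:E) (fun y => (e2 (x - p y))%:E) (cst 1%:E)).
  - by move=> n; exact: (measurable_section (mp_ n) x).
  - exact: (measurable_section mp x).
  - apply: aeW => y _; have [c1 c2] := cp y.
    apply: cvg_EFin; first by apply: nearW.
    by apply: cvg_gker2; (apply: cvgB; first exact: cvg_cst).
  - exact: finite_measure_integrable_cst.
  - by apply: aeW => y n _; rewrite lee_fin ger0_norm ?expR_ge0// gker2_le1.
move: h; rewrite -(potentialE mp) => /fine_cvgP[_].
exact.
Qed.

End potential.

(** * The hinge inequality for arbitrary probability measures *)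

Lemma cvg_hinge (R : realType) (a : R) (u v : nat -> R) (l m : R) :
  u n @[n --> \oo] --> l -> v n @[n --> \oo] --> m ->
  Num.max (u n - a) 0 + Num.min (v n) a @[n --> \oo] -->
  Num.max (l - a) 0 + Num.min m a.
Proof.
move=> ul vm.
have ca : a @[_ --> \oo] --> a by exact: cvg_cst.
have ua : u n - a @[n --> \oo] --> l - a by exact: cvgB.
have va : v n - a @[n --> \oo] --> m - a by exact: cvgB.
have vb : v n + a @[n --> \oo] --> m + a by exact: cvgD.
under eq_fun do rewrite maxr_absE minr_absE !subr0 !addr0.
rewrite maxr_absE minr_absE !subr0 !addr0; apply: cvgD; apply: cvgMl.
  by apply: cvgD; [exact: ua|exact: cvg_norm ua].
by apply: cvgB; [exact: vb|exact: cvg_norm va].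
Qed.

Section hinge.
Context (R : realType) (s : R) (s0 : 0 < s) (T : plane R -> plane R).
Hypothesis T_lip : lipschitz1_norm2 T.
Variable a : R.
Hypothesis a0 : 0 < a.

Let finite_hinge_seq (r : seq (plane R)) (w : plane R -> R) : (forall k, 0 <= w k) ->
  (\int[leb2 R]_x (Num.max (gmix (@dot2 R) s r w id x - a) 0)%:E <=
   \int[leb2 R]_x (Num.max (gmix (@dot2 R) s r w T x - a) 0)%:E)%E.
Proof.
move=> w0.
pose p (i : 'I_(size r)) := nth 0 r i.
(* The sum of all squared distances bounds each of them. *)
pose D := \sum_i \sum_j dot2 (p i - p j) (p i - p j).
have ordE (P : plane R -> plane R) x :
    gmix (@dot2 R) s r w P x = gmix (@dot2 R) s (index_enum 'I_(size r)) (w \o p) (P \o p) x.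
  by rewrite /gmix (big_nth 0) big_mkord.
under eq_integral do rewrite ordE.
under [leRHS]eq_integral do rewrite ordE.
apply: (@finite_hinge_le R s s0 _ _ _ _ _ D) => //.
- by move=> i /=; exact: w0.
- by move=> i j /=; exact: lipschitz_dot2.
- move=> i j /=; rewrite /D (bigD1 i)//= (bigD1 j)//= -addrA lerDl.
  rewrite addr_ge0// ?sumr_ge0// => k _; first exact: dot2_ge0.
  by apply: sumr_ge0 => l _; exact: dot2_ge0.
- by apply: sumr_ge0 => i _; apply: sumr_ge0 => j _; exact: dot2_ge0.
Qed.

(** Replacing [id] by a finitely valued [f n] makes the measure finitely supported, and [T \o f n]
    moves the same atoms by [T], so the finite case applies before the limit. The truncated form is
    the one that concave functions are built from. *)
Lemma hinge_le (mu : probability (plane R) R) :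
  (\int[leb2 R]_x (Num.min (potential s mu T x) a)%:E <=
   \int[leb2 R]_x (Num.min (potential s mu id x) a)%:E)%E.
Proof.
have [f fv fc] := finite_valued_approx R.
have mT := lipschitz_measurable T_lip.
have mfin r g : finite_valued_on r g -> measurable_fun setT g.
  move=> rg; apply/measurable_fun_pairP; split.
    exact: (measurable_finite_valued fst rg).
  exact: (measurable_finite_valued snd rg).
have mf n : measurable_fun setT (f n) by have [r /mfin] := fv n.
have mTf n : measurable_fun setT (T \o f n) by exact: measurableT_comp.
have step n : (\int[leb2 R]_x (Num.max (potential s mu (f n) x - a) 0)%:E <=
    \int[leb2 R]_x (Num.max (potential s mu (T \o f n) x - a) 0)%:E)%E.
  have [r rf] := fv n; have [_ _ mr] := rf.
  pose w k := fine (mu (f n @^-1` [set k])).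
  have mixE (P : plane R -> plane R) x :
      potential s mu (P \o f n) x = gmix (@dot2 R) s r w P x.
    rewrite /potential (@integral_finite_valued R r (f n) (fun k => gker (@dot2 R) s (x - P k)) mu rf)/=.
      by apply: eq_bigr => k _; rewrite mulrC.
    by move=> k; exact: expR_ge0.
  under eq_integral do rewrite (mixE id).
  under [leRHS]eq_integral do rewrite (mixE T).
  by apply: finite_hinge_seq => k; rewrite fine_ge0// measure_ge0.
(* Fatou is applied to this sum, whose integral is at most the total mass by
   [step]; in the limit it compares [id] in the first summand with [T] in the
   second. *)
pose F n x := Num.max (potential s mu (f n) x - a) 0 + Num.min (potential s mu (T \o f n) x) a.
pose F' x := Num.max (potential s mu id x - a) 0 + Num.min (potential s mu T x) a.
have mmax p : measurable_fun setT p ->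
    measurable_fun setT (fun x => Num.max (potential s mu p x - a) 0).
  move=> mp; apply: measurable_maxr => //; apply: measurable_funB => //.
  exact: (measurable_potential s0 mu mp).
have mmin p : measurable_fun setT p ->
    measurable_fun setT (fun x => Num.min (potential s mu p x) a).
  by move=> mp; apply: measurable_minr => //; exact: (measurable_potential s0 mu mp).
have max0 p x : 0 <= Num.max (potential s mu p x - a) 0 by rewrite le_max lexx orbT.
have min0 p x : measurable_fun setT p -> 0 <= Num.min (potential s mu p x) a.
  by move=> mp; rewrite le_min potential_ge0//= ltW.
have split p q : measurable_fun setT p -> measurable_fun setT q ->
    (\int[leb2 R]_x (Num.max (potential s mu p x - a) 0 + Num.min (potential s mu q x) a)%:E =
     \int[leb2 R]_x (Num.max (potential s mu p x - a) 0)%:E +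
     \int[leb2 R]_x (Num.min (potential s mu q x) a)%:E)%E.
  move=> mp mq; under eq_integral do rewrite EFinD.
  rewrite ge0_integralD//.
  - by move=> x _; rewrite lee_fin max0.
  - by apply/measurable_EFinP; exact: (mmax _ mp).
  - by move=> x _; rewrite lee_fin min0.
  - by apply/measurable_EFinP; exact: (mmin _ mq).
have Fle n : (\int[leb2 R]_x (F n x)%:E <= gauss_mass s)%E.
  rewrite split//; rewrite -(integral_potential_hinge s0 mu (mTf n) a0).
  by rewrite leeD2r.
have F'le : (\int[leb2 R]_x (F' x)%:E <= gauss_mass s)%E.
  have -> : (\int[leb2 R]_x (F' x)%:E =
      \int[leb2 R]_x limn_einf (fun n => (F n x)%:E))%E.
    apply: eq_integral => x _; apply/esym.
    apply: (cvg_limn_einf_sup _).1; apply: cvg_EFin; first exact: nearW.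
    have c1 : potential s mu (f n) x @[n --> \oo] --> potential s mu id x.
      exact: potential_cvg.
    have c2 : potential s mu (T \o f n) x @[n --> \oo] --> potential s mu T x.
      by apply: potential_cvg => // y; have [? ?] := fc y; exact: lipschitz_cvg.
    exact: (cvg_hinge c1 c2).
  apply: (@le_trans _ _ (limn_einf (fun n => \int[leb2 R]_x (F n x)%:E)%E)).
    apply: fatou => //.
    - move=> n; apply/measurable_EFinP; apply: measurable_funD; [exact: (mmax _ (mf n))|exact: (mmin _ (mTf n))].
    - by move=> n x _; rewrite lee_fin addr_ge0// min0.
  rewrite limn_einf_lim; apply: lime_le; first exact: is_cvg_einfs.
  by apply: nearW => n; apply: le_trans (Fle n); apply: ereal_inf_lbound; exists n => /=.
have mid : measurable_fun setT (id : plane R -> plane R) by [].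
have F'E := split id T mid mT.
have massE := integral_potential_hinge s0 mu mid a0.
move: F'le; rewrite {}/F' {}F'E -{}massE.
set A := (\int[leb2 R]_x (Num.max _ _)%:E)%E; set B := (\int[leb2 R]_x _)%E.
set C := (\int[leb2 R]_x _)%E => ABC.
have A0 : (0 <= A)%E by apply: integral_ge0 => x _; rewrite lee_fin max0.
have C0 : (0 <= C)%E by apply: integral_ge0 => x _; rewrite lee_fin min0.
(* Finiteness of the hinge integral of [id] lets it be cancelled from both sides of [ABC]. *)
have Afin : A \is a fin_num.
  rewrite ge0_fin_numE//; apply: le_lt_trans (gauss_mass_lty s0).
  by rewrite -(integral_potential_hinge s0 mu mid a0); exact: leeDl.
by rewrite leeD2lE in ABC.
Qed.

End hinge.

(** * Concave functions as limits of truncations *)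

Section concave_interpolation.
Context (R : realType) (V : R -> R) (M : R).
Hypothesis M0 : 0 < M.
Hypothesis V0 : V 0 = 0.
Hypothesis V_ndecr : forall x y, 0 <= x -> x <= y -> y <= M -> V x <= V y.
Hypothesis V_concave : forall x y z, 0 <= x -> x <= y -> y <= z -> z <= M ->
  (V z - V y) * (y - x) <= (V y - V x) * (z - y).

Section grid.
Variable N : nat.

Let h := M / N.+1%:R.
Let a k := k%:R * h.

Let h0 : 0 < h. Proof. by rewrite divr_gt0. Qed.

Let a0 k : 0 <= a k. Proof. by rewrite mulr_ge0// ltW. Qed.

Let aS k : a k.+1 - a k = h.
Proof. by rewrite /a -natr1 mulrDl mul1r addrAC subrr add0r. Qed.

Let a_homo j k : (j <= k)%N -> a j <= a k.
Proof. by move=> jk; rewrite ler_pM2r// ler_nat. Qed.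

Let aM : a N.+1 = M.
Proof. by rewrite /a /h mulrC divfK// pnatr_eq0. Qed.

Let a_le k : (k <= N.+1)%N -> a k <= M.
Proof. by move=> kN; rewrite -aM; exact: a_homo. Qed.

(** The value 0 past the last cell makes the last coefficient equal to the last slope. *)
Definition grid_slope k : R := if (k < N.+1)%N then (V (a k.+1) - V (a k)) / h else 0.

Definition grid_coef k : R := grid_slope k - grid_slope k.+1.

(** The piecewise linear interpolant of [V] on [0, M], written with truncations: the coefficients
    are the drops of slope at the nodes. *)
Definition interp (t : R) : R :=
  \sum_(0 <= k < N.+1) grid_coef k * Num.min t (k.+1%:R * h).

Let slope_ge0 k : 0 <= grid_slope k.
Proof.
rewrite /grid_slope; case: ifP => // kN; rewrite divr_ge0 ?(ltW h0)// subr_ge0.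
by apply: V_ndecr; rewrite ?a0 ?a_le// a_homo.
Qed.

(** Concavity makes the slopes decrease; monotonicity makes the last one nonnegative. *)
Lemma grid_coef_ge0 k : 0 <= grid_coef k.
Proof.
rewrite /grid_coef {2}/grid_slope; case: ifP => kN; last by rewrite subr0.
rewrite /grid_slope ltnW// subr_ge0 ler_pM2r ?invr_gt0//.
have := @V_concave (a k) (a k.+1) (a k.+2) (a0 _) (a_homo (leqnSn _)) (a_homo (leqnSn _)) (a_le kN).
by rewrite !aS ler_pM2r.
Qed.

Let abel (d m : nat -> R) n :
  \sum_(0 <= k < n) (d k - d k.+1) * m k.+1 =
  \sum_(0 <= k < n) d k * (m k.+1 - m k) + d 0%N * m 0%N - d n * m n.
Proof.
elim: n => [|n IH]; first by rewrite !big_geq// add0r subrr.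
by rewrite !big_nat_recr//= IH; ring.
Qed.

(** After summation by parts, cells before [j] contribute full increments that telescope to
    [V (a j)], and cells after [j] contribute nothing. *)
Lemma interpE t j : 0 <= t -> (j < N.+1)%N -> a j <= t -> t <= a j.+1 ->
  interp t = V (a j) + grid_slope j * (t - a j).
Proof.
move=> t0 jN ajt taj; rewrite /interp (abel grid_slope (fun k => Num.min t (a k))).
rewrite /grid_slope ltnn mul0r subr0.
rewrite (_ : Num.min t (a 0%N) = 0) ?mulr0 ?addr0; last by rewrite /a mul0r min_r.
rewrite (big_cat_nat _ (n := j)) ?(ltnW jN)//= (@big_ltn _ _ _ j)//=.
rewrite [X in _ + (_ + X)](_ : _ = 0) ?addr0; last first.
  rewrite big_nat big1// => k /andP[jk _].
  have tk : t <= a k by apply: (le_trans taj); exact: a_homo.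
  by rewrite !min_l ?subrr ?mulr0// (le_trans tk)// a_homo.
rewrite jN (min_l taj) (min_r ajt); congr (_ + _).
transitivity (\sum_(0 <= k < j) (V (a k.+1) - V (a k))).
  rewrite big_nat [RHS]big_nat; apply: eq_bigr => k /andP[_ kj].
  have kt : a k.+1 <= t by apply: le_trans ajt; exact: a_homo.
  rewrite (ltn_trans kj jN) !min_r// ?aS ?(le_trans _ kt)// ?a_homo//.
  by rewrite divfK// gt_eqF.
by rewrite telescope_sumr// {2}/a mul0r V0 subr0.
Qed.

Let cell t : 0 <= t -> t <= M -> exists2 j, (j < N.+1)%N & a j <= t <= a j.+1.
Proof.
move=> t0 tM.
have [|] := ltP t M; last first.
  move=> Mt; have -> : t = M by apply/eqP; rewrite eq_le tM.
  by exists N => //; rewrite aM lexx andbT a_le.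
move=> tltM; exists (Num.truncn (t / h)).
  rewrite -(ltr_nat R); apply: (@le_lt_trans _ _ (t / h)).
    by rewrite truncn_le// divr_ge0// ltW.
  by rewrite ltr_pdivrMr// -[_ * h]/(a N.+1) aM.
have th0 : 0 <= t / h by rewrite divr_ge0// ltW.
apply/andP; split; first by rewrite /a -ler_pdivlMr// truncn_le.
by rewrite /a -ler_pdivrMr// ltW// truncnS_gt.
Qed.

Lemma interp_le t : 0 <= t -> t <= M -> interp t <= V t.
Proof.
move=> t0 tM; have [j jN /andP[jt tj]] := cell t0 tM.
rewrite (interpE t0 jN jt tj) /grid_slope jN addrC -lerBrDr.
rewrite mulrAC ler_pdivrMr//.
have := @V_concave (a j) t (a j.+1) (a0 _) jt tj (a_le jN).
have := aS j; set x := a j; set y := a j.+1 => <-; nra.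
Qed.

(** The interpolant is at least V(a_j) at the left node; concavity on [0, t] with V(0) = 0 gives
    V(a_j) >= (a_j / t) V(t), and a_j >= t - h. *)
Lemma interp_ge t : 0 < t -> t <= M -> (1 - h / t) * V t <= interp t.
Proof.
move=> t0 tM; have [j jN /andP[jt tj]] := cell (ltW t0) tM.
rewrite (interpE (ltW t0) jN jt tj).
have Vt : 0 <= V t by rewrite -V0; apply: V_ndecr => //; exact: ltW.
apply: (@le_trans _ _ (V (a j))); last first.
  by rewrite lerDl mulr_ge0// subr_ge0.
have := @V_concave 0 (a j) t (lexx 0) (a0 j) jt tM; rewrite V0 !subr0 => H.
have H2 : V t * a j <= V (a j) * t by nra.
have H3 : (1 - h / t) * V t * t <= V (a j) * t.
  apply: le_trans H2; have -> : (1 - h / t) * V t * t = V t * (t - h) by field; rewrite gt_eqF.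
  by rewrite ler_wpM2l// lerBlDr -lerBlDl; have := aS j; lra.
by rewrite ler_pM2r in H3.
Qed.

Lemma interp0 : interp 0 = 0.
Proof.
rewrite (@interpE 0 0%N) ?a_homo//.
  by rewrite /a mul0r V0 subr0 mulr0 addr0.
by rewrite /a mul0r.
Qed.

End grid.

Lemma interp_cvg t : 0 <= t -> t <= M -> interp n t @[n --> \oo] --> V t.
Proof.
(* The origin is separate because [V] may jump there. *)
rewrite le_eqVlt => /predU1P[<- _|t0 tM].
  by rewrite V0; under eq_fun do rewrite interp0; exact: cvg_cst.
have Vt : 0 <= V t by rewrite -V0; apply: V_ndecr => //; exact: ltW.
apply: (@squeeze_cvgr _ _ _ _ (fun n => (1 - (M / t) * n.+1%:R^-1) * V t) (fun=> V t)).
- near=> n; rewrite interp_le ?(ltW t0)// andbT.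
  apply: le_trans (interp_ge n t0 tM); rewrite ler_wpM2r// lerB//.
  by rewrite mulrAC.
- rewrite -[X in _ --> X]mul1r; apply: cvgMl.
  rewrite -[X in _ --> X]subr0 -[X in _ - X](mulr0 (M / t)).
  apply: cvgB; first exact: cvg_cst.
  by apply: cvgMr; exact: cvg_harmonic.
- exact: cvg_cst.
Unshelve. all: by end_near. Qed.

End concave_interpolation.

Section concave_comparison.
Context d (T : measurableType d) (R : realType) (m : {measure set T -> \bar R}).
Variables (V : R -> R) (M : R).
Hypothesis M0 : 0 < M.
Hypothesis V0 : V 0 = 0.
Hypothesis V_ndecr : forall x y, 0 <= x -> x <= y -> y <= M -> V x <= V y.
Hypothesis V_concave : forall x y z, 0 <= x -> x <= y -> y <= z -> z <= M ->
  (V z - V y) * (y - x) <= (V y - V x) * (z - y).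

Lemma measurable_ndecr_comp (f : T -> R) : measurable_fun setT f ->
  (forall x, 0 <= f x <= M) -> measurable_fun setT (fun x => V (f x)).
Proof.
move=> mf fM.
(* Clamping the argument to [0, M] gives a function monotone on the whole line, hence measurable. *)
pose W t := V (Num.max 0 (Num.min t M)).
have mW : measurable_fun setT W.
  apply: nondecreasing_measurable => // x y xy; apply: V_ndecr.
  - by rewrite le_max lexx.
  - have xyM : Num.min x M <= Num.min y M.
      by rewrite le_min !ge_min xy lexx orbT.
    by rewrite ge_max !le_max lexx xyM orbT.
  - by rewrite ge_max ge_min lexx orbT ltW.
rewrite (_ : (fun x => _) = W \o f); first exact: measurableT_comp.
apply/funext => x /=; have /andP[f0 f1] := fM x.
by rewrite /W (min_l f1) (max_r f0).
Qed.

(** The interpolants compare term by term. For [f] they lie below [V], and for [g] Fatou's lemma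
    recovers [V] in the limit. *)
Lemma ge0_le_integral_concave (f g : T -> R) :
  measurable_fun setT f -> measurable_fun setT g ->
  (forall x, 0 <= f x <= M) -> (forall x, 0 <= g x <= M) ->
  (forall a, 0 < a ->
    (\int[m]_x (Num.min (g x) a)%:E <= \int[m]_x (Num.min (f x) a)%:E)%E) ->
  (\int[m]_x (V (g x))%:E <= \int[m]_x (V (f x))%:E)%E.
Proof.
move=> mf mg fM gM fg.
have grid0 n k : 0 < k.+1%:R * (M / n.+1%:R) by rewrite mulr_gt0// divr_gt0.
have c0 n k : 0 <= grid_coef V M n k by exact: grid_coef_ge0.
have term0 (p : T -> R) n k x : 0 <= p x <= M ->
    0 <= grid_coef V M n k * Num.min (p x) (k.+1%:R * (M / n.+1%:R)).
  by move=> /andP[p0 _]; rewrite mulr_ge0// le_min p0 ltW.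
have mterm (p : T -> R) n k : measurable_fun setT p -> measurable_fun setT
    (fun x => grid_coef V M n k * Num.min (p x) (k.+1%:R * (M / n.+1%:R))).
  by move=> mp; apply: measurable_funM => //; exact: measurable_minr.
have minterp (p : T -> R) n : measurable_fun setT p ->
    measurable_fun setT (fun x => interp V M n (p x)).
  by move=> mp; apply: measurable_sum => k; exact: mterm.
have interp_ge0 (p : T -> R) n x : 0 <= p x <= M -> 0 <= interp V M n (p x).
  by move=> pM; apply: sumr_ge0 => k _; exact: term0.
have sumE (p : T -> R) n : measurable_fun setT p -> (forall x, 0 <= p x <= M) ->
    (\int[m]_x (interp V M n (p x))%:E = \sum_(0 <= k < n.+1)
       (grid_coef V M n k)%:E * \int[m]_x (Num.min (p x) (k.+1%:R * (M / n.+1%:R)))%:E)%E.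
  move=> mp pM; under eq_integral do rewrite -sumEFin.
  rewrite ge0_integral_sum//; last 2 first.
  - by move=> k; apply/measurable_EFinP; exact: mterm.
  - by move=> k x _; rewrite lee_fin term0.
  apply: eq_bigr => k _; under eq_integral do rewrite EFinM.
  rewrite ge0_integralZl//.
  - by apply/measurable_EFinP; exact: measurable_minr.
  - by move=> x _; rewrite lee_fin le_min (ltW (grid0 _ _)) andbT; case/andP: (pM x).
  - by rewrite lee_fin.
have le_n n : (\int[m]_x (interp V M n (g x))%:E <= \int[m]_x (V (f x))%:E)%E.
  apply: (@le_trans _ _ (\int[m]_x (interp V M n (f x))%:E)%E).
    rewrite !sumE//; apply: lee_sum => k _.
    by apply: lee_wpmul2l; [rewrite lee_fin|exact: fg].
  apply: ge0_le_integral => //.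
  - by move=> x _; rewrite lee_fin interp_ge0.
  - by apply/measurable_EFinP; exact: minterp.
  - by apply/measurable_EFinP; exact: measurable_ndecr_comp.
  - by move=> x _; rewrite lee_fin; case/andP: (fM x) => ? ?; exact: interp_le.
have -> : (\int[m]_x (V (g x))%:E = \int[m]_x limn_einf (fun n => (interp V M n (g x))%:E))%E.
  apply: eq_integral => x _; apply/esym.
  apply: (cvg_limn_einf_sup _).1; apply: cvg_EFin; first exact: nearW.
  by case/andP: (gM x) => ? ?; exact: interp_cvg.
apply: (@le_trans _ _ (limn_einf (fun n => \int[m]_x (interp V M n (g x))%:E)%E)).
  apply: fatou => //.
  - by move=> n; apply/measurable_EFinP; exact: minterp.
  - by move=> n x _; rewrite lee_fin interp_ge0.
rewrite limn_einf_lim; apply: lime_le; first exact: is_cvg_einfs.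
by apply: nearW => n; apply: le_trans (le_n n); apply: ereal_inf_lbound; exists n => /=.
Qed.

End concave_comparison.

(** * From concave to convex functions *)

Section convex_comparison.
Context (R : realType) (U : R -> R).
Hypothesis U_convex : convex_function (`[0, +oo[%classic : set R) U.
Hypothesis U0 : U 0 = 0.

(** Monotonicity of chord slopes, with denominators cleared so that coinciding points are
    allowed. *)
Lemma convex_slopes x y z : 0 <= x -> x <= y -> y <= z ->
  (U y - U x) * (z - y) <= (U z - U y) * (y - x).
Proof.
move=> x0; rewrite le_eqVlt => /predU1P[<-|xy]; first by rewrite !subrr mul0r mulr0.
rewrite le_eqVlt => /predU1P[<-|yz]; first by rewrite !subrr mulr0 mul0r.
have xz : 0 < z - x by rewrite subr_gt0 (lt_trans xy).
have t0 : 0 <= (z - y) / (z - x) by rewrite divr_ge0 ?subr_ge0 ?(ltW yz)// ltW// -subr_gt0.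
have t1 : (z - y) / (z - x) <= 1 by rewrite ler_pdivrMr// mul1r lerB// ltW.
have := @U_convex (Itv01 t0 t1) x z.
rewrite !inE/= !in_itv/= !andbT x0 (le_trans x0 (ltW (lt_trans xy yz))) => /(_ erefl erefl).
rewrite !convRE/= /unstable.onem.
have -> : conv (Itv01 t0 t1) (x : convex_lmodType R^o) z = y.
  rewrite -[LHS]/((z - y) / (z - x) * x + (1 - (z - y) / (z - x)) * z).
  by field; rewrite gt_eqF.
move=> H.
have H2 : U y * (z - x) <= (z - y) * U x + (y - x) * U z.
  rewrite -ler_pdivlMr//; apply: (le_trans H).
  rewrite le_eqVlt; apply/orP; left; apply/eqP; field; by rewrite gt_eqF.
lra.
Qed.

Context d (T : measurableType d) (m : {measure set T -> \bar R}).
Variable (M : R) (f g : T -> R).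
Hypothesis M0 : 0 < M.
Hypothesis mf : measurable_fun setT f.
Hypothesis mg : measurable_fun setT g.
Hypothesis fM : forall x, 0 <= f x <= M.
Hypothesis gM : forall x, 0 <= g x <= M.
Hypothesis fg : (\int[m]_x (f x)%:E = \int[m]_x (g x)%:E)%E.
Hypothesis f_lty : (\int[m]_x (f x)%:E < +oo)%E.
Hypothesis min_le : forall a, 0 < a ->
  (\int[m]_x (Num.min (g x) a)%:E <= \int[m]_x (Num.min (f x) a)%:E)%E.

(** The slope of [U] over [M, 2M] dominates every slope within [0, M], so [V] is nondecreasing
    there; clipping at 0 keeps [c * t] nonnegative. *)
Let c := Num.max 0 ((U (2 * M) - U M) / M).
Let V t := c * t - U t.

Let c0 : 0 <= c. Proof. by rewrite le_max lexx. Qed.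

Let V0 : V 0 = 0. Proof. by rewrite /V mulr0 U0 subrr. Qed.

Let V_ndecr x y : 0 <= x -> x <= y -> y <= M -> V x <= V y.
Proof.
move=> x0 xy yM.
have s1 : (U y - U x) * M <= (U (2 * M) - U M) * (y - x).
  have M2 : M <= 2 * M by rewrite mulr_natl mulr2n lerDl ltW.
  have e1 := convex_slopes x0 xy yM.
  have e2 := convex_slopes x0 (le_trans xy yM) M2.
  have [xM|] := ltP x M; last first.
    move=> Mx; have -> : y = x by apply/eqP; rewrite eq_le xy (le_trans yM).
    by rewrite !subrr !(mulr0, mul0r).
  have h : 0 < M - x by rewrite subr_gt0.
  rewrite -(ler_pM2r h).
  have e3 : (U y - U x) * (M - x) <= (U M - U x) * (y - x) by nra.
  have yx0 : 0 <= y - x by rewrite subr_ge0.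
  have e4 := ler_wpM2l yx0 e2.
  have MM : 0 <= 2 * M - M by rewrite subr_ge0.
  have e5 := ler_wpM2r MM e3.
  nra.
have cM : U (2 * M) - U M <= c * M by rewrite -ler_pdivrMr// le_max lexx orbT.
have yx0 : 0 <= y - x by rewrite subr_ge0.
have e6 := ler_wpM2r yx0 cM.
have e7 : (U y - U x) * M <= c * (y - x) * M by apply: (le_trans s1); rewrite mulrAC.
rewrite ler_pM2r// in e7.
by rewrite /V; lra.
Qed.

Let V_concave x y z : 0 <= x -> x <= y -> y <= z -> z <= M ->
  (V z - V y) * (y - x) <= (V y - V x) * (z - y).
Proof.
move=> x0 xy yz zM; have := convex_slopes x0 xy yz; rewrite /V; nra.
Qed.

Let V_ge0 t : 0 <= t <= M -> 0 <= V t.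
Proof. by move=> /andP[t0 tM]; rewrite -V0; exact: V_ndecr. Qed.

Let UE t : U t = c * t - V t. Proof. by rewrite /V; ring. Qed.

Let mV (p : T -> R) : measurable_fun setT p -> (forall x, 0 <= p x <= M) ->
  measurable_fun setT (fun x => (V (p x))%:E).
Proof. by move=> mp pM; apply/measurable_EFinP; exact: (measurable_ndecr_comp M0 V_ndecr). Qed.

Let int_c (p : T -> R) : measurable_fun setT p -> (forall x, 0 <= p x <= M) ->
  (\int[m]_x (p x)%:E < +oo)%E -> m.-integrable setT (fun x => (c * p x)%:E).
Proof.
move=> mp pM plty; under eq_fun do rewrite EFinM.
apply: integrableZl => //; apply/integrableP; split; first exact/measurable_EFinP.
rewrite (eq_integral (fun x => (p x)%:E))// => x _.
by rewrite gee0_abs// lee_fin; case/andP: (pM x).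
Qed.

Let integral_finite (p : T -> R) : measurable_fun setT p -> (forall x, 0 <= p x <= M) ->
  (\int[m]_x (p x)%:E < +oo)%E -> (\int[m]_x (V (p x))%:E < +oo)%E ->
  (\int[m]_x (U (p x))%:E = c%:E * \int[m]_x (p x)%:E - \int[m]_x (V (p x))%:E)%E.
Proof.
move=> mp pM plty Vlty.
under eq_integral do rewrite UE EFinB.
rewrite integralB//; last 2 first.
- exact: int_c.
- apply/integrableP; split; first exact: mV.
  rewrite (eq_integral (fun x => (V (p x))%:E))// => x _.
  by rewrite gee0_abs// lee_fin V_ge0.
congr (_ - _)%E; under eq_integral do rewrite EFinM.
rewrite ge0_integralZl//; first exact/measurable_EFinP.
by move=> x _; rewrite lee_fin; case/andP: (pM x).
Qed.

(** The positive part of U(p) is at most c p, which has finite integral; the negative part then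
    carries the infinite mass of V(p), and no difference of infinities arises. *)
Let integral_infinite (p : T -> R) : measurable_fun setT p -> (forall x, 0 <= p x <= M) ->
  (\int[m]_x (p x)%:E < +oo)%E -> (\int[m]_x (V (p x))%:E = +oo)%E ->
  (\int[m]_x (U (p x))%:E = -oo)%E.
Proof.
move=> mp pM plty Vy.
have mU : measurable_fun setT (fun x => (U (p x))%:E).
  under eq_fun do rewrite UE EFinB; apply: emeasurable_funB; last exact: mV.
  by apply/measurable_EFinP; exact: measurable_funM.
have cp0 x : 0 <= c * p x by rewrite mulr_ge0//; case/andP: (pM x).
have clty : (\int[m]_x (c * p x)%:E < +oo)%E.
  have /integrableP[_] := int_c mp pM plty.
  by rewrite (eq_integral (fun x => (c * p x)%:E))// => x _; rewrite gee0_abs// lee_fin.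
have mcp : measurable_fun setT (fun x => (c * p x)%:E).
  by apply/measurable_EFinP; exact: measurable_funM.
rewrite integralE.
have pos : (\int[m]_x ((fun x => (U (p x))%:E)^\+ x) < +oo)%E.
  apply: le_lt_trans clty; apply: ge0_le_integral => //.
  - exact: measurable_funepos.
  - move=> x _; rewrite funeposE ge_max !lee_fin cp0 andbT UE lerBlDr lerDl.
    exact: V_ge0.
have neg : (\int[m]_x ((fun x => (U (p x))%:E)^\- x) = +oo)%E.
  have : (\int[m]_x (V (p x))%:E <=
     \int[m]_x (c * p x)%:E + \int[m]_x ((fun x => (U (p x))%:E)^\- x))%E.
    rewrite -ge0_integralD//; last 2 first.
    - by move=> x _; rewrite lee_fin.
    - exact: measurable_funeneg.
    apply: ge0_le_integral => //.
    - by move=> x _; rewrite lee_fin V_ge0.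
    - exact: mV.
    - by apply: emeasurable_funD => //; exact: measurable_funeneg.
    - move=> x _; rewrite /V EFinB leeD2l//.
      by rewrite funenegE le_max lexx.
  rewrite Vy leye_eq => /eqP h.
  apply/eqP; rewrite -leye_eq leNgt; apply/negP => Nlt.
  by have := lte_add_pinfty clty Nlt; rewrite h ltxx.
by rewrite neg addeNy.
Qed.

(** If V(f) has infinite integral, the left side is [-oo]. Otherwise V(g) is integrable too, and the
    linear parts agree because [f] and [g] have the same mass. *)
Lemma le_integral_convex :
  (\int[m]_x (U (f x))%:E <= \int[m]_x (U (g x))%:E)%E.
Proof.
have Vle := ge0_le_integral_concave M0 V0 V_ndecr V_concave mf mg fM gM min_le.
have [Vf|] := eqVneq (\int[m]_x (V (f x))%:E)%E +oo%E.
  by rewrite (integral_infinite mf fM f_lty Vf) leNye.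
rewrite -ltey => Vf.
have g_lty : (\int[m]_x (g x)%:E < +oo)%E by rewrite -fg.
rewrite (integral_finite mf fM f_lty Vf) (integral_finite mg gM g_lty (le_lt_trans Vle Vf)).
by rewrite fg leeB.
Qed.

End convex_comparison.

(** * Gaussian convolutions as multiples of potentials, and the conclusion *)

Section gauss_conv_potential.
Context (R : realType) (s : R) (s0 : 0 < s) (mu : probability (plane R) R).

Lemma gauss2E x : gauss2 s x = (2 * pi * s)^-1 * gker (@dot2 R) s x.
Proof. by rewrite /gauss2 norm2_sqr. Qed.

Lemma gauss_peak_gt0 : 0 < (2 * pi * s)^-1.
Proof. by rewrite invr_gt0 !mulr_gt0// pi_gt0. Qed.

Lemma integral_gauss2 (p : plane R -> plane R) x : measurable_fun setT p ->
  (\int[mu]_y (gauss2 s (x - p y))%:E = ((2 * pi * s)^-1 * potential s mu p x)%:E)%E.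
Proof.
move=> mp; under eq_integral do rewrite gauss2E EFinM.
rewrite ge0_integralZl//.
- by rewrite EFinM potentialE.
- exact: (measurable_section s mp x).
- by move=> y _; rewrite lee_fin expR_ge0.
- by rewrite lee_fin ltW// gauss_peak_gt0.
Qed.

Lemma gauss_convE x : gauss_conv mu s x = (2 * pi * s)^-1 * potential s mu id x.
Proof. by rewrite /gauss_conv (@integral_gauss2 id x). Qed.

Lemma gauss_conv_pushforwardE (T : plane R -> plane R) x : measurable_fun setT T ->
  gauss_conv (pushforward mu T) s x = (2 * pi * s)^-1 * potential s mu T x.
Proof.
move=> mT; rewrite /gauss_conv.
have mg : measurable_fun setT (fun y : plane R => (gauss2 s (x - y))%:E).
  under eq_fun do rewrite gauss2E; apply/measurable_EFinP; apply: measurable_funM => //.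
  apply/measurable_EFinP; apply: (@measurable_section R s id) => //.
have g0 : {in setT, forall y : plane R, (0 <= (gauss2 s (x - y))%:E)%E}.
  by move=> y _; rewrite gauss2E lee_fin mulr_ge0 ?expR_ge0// ltW// gauss_peak_gt0.
have := ge0_integral_pushforward mT mu measurableT mg g0.
rewrite preimage_setT => e.
by have -> := congr1 fine e; rewrite /comp (integral_gauss2 x mT).
Qed.

End gauss_conv_potential.

(* [U] is constrained only on [0, +oo[; its arguments below are nonnegative. *)
Theorem theorem1p2 (R : realType) (T : plane R -> plane R)
  (T_lip : lipschitz1_norm2 T) (mu : probability (plane R) R)
  (s : R) (s_gt0 : 0 < s)
  (U : R -> R) (U_convex : convex_function (`[0, +oo[%classic : set R) U)
  (U0 : U 0 = 0) :
  (\int[lebesgue2 R]_x (U (gauss_conv mu s x))%:E <=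
   \int[lebesgue2 R]_x (U (gauss_conv (pushforward mu T) s x))%:E)%E.
Proof.
have mT := lipschitz_measurable T_lip.
have mid : measurable_fun setT (id : plane R -> plane R) by [].
set M := (2 * pi * s)^-1.
have M0 : 0 < M by exact: gauss_peak_gt0.
under eq_integral do rewrite gauss_convE//.
under [leRHS]eq_integral do rewrite gauss_conv_pushforwardE//.
have mp p : measurable_fun setT p ->
    measurable_fun setT (fun x => M * potential s mu p x).
  by move=> mp; apply: measurable_funM => //; exact: (measurable_potential s_gt0 mu mp).
have pM p : measurable_fun setT p -> forall x, 0 <= M * potential s mu p x <= M.
  move=> mp' x; rewrite mulr_ge0 ?(ltW M0) ?potential_ge0//=.
  by rewrite ler_piMr ?(ltW M0)// potential_le1.
have intE p : measurable_fun setT p ->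
    (\int[leb2 R]_x (M * potential s mu p x)%:E = M%:E * gauss_mass s)%E.
  move=> mp'; under eq_integral do rewrite EFinM.
  rewrite ge0_integralZl//.
  - by rewrite integral_potential.
  - by apply/measurable_EFinP; exact: (measurable_potential s_gt0 mu mp').
  - by move=> x _; rewrite lee_fin potential_ge0.
  - by rewrite lee_fin ltW.
(* Restoring the normalising constant [M] moves the truncation level from [a] to [a / M]. *)
have minE a p : 0 < a -> measurable_fun setT p ->
    (\int[leb2 R]_x (Num.min (M * potential s mu p x) a)%:E =
     M%:E * \int[leb2 R]_x (Num.min (potential s mu p x) (a / M))%:E)%E.
  move=> a0 mp'; rewrite -ge0_integralZl//.
  - apply: eq_integral => x _; rewrite -EFinM minr_pMr ?(ltW M0)//.
    by rewrite [M * (a / M)]mulrC divfK// gt_eqF.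
  - apply/measurable_EFinP; apply: measurable_minr => //.
    exact: (measurable_potential s_gt0 mu mp').
  - by move=> x _; rewrite lee_fin le_min potential_ge0//= divr_ge0 ?(ltW a0) ?(ltW M0).
  - by rewrite lee_fin ltW.
apply: (@le_integral_convex R U U_convex U0 _ _ (leb2 R) M _ _ M0
  (mp _ mid) (mp _ mT) (pM _ mid) (pM _ mT)).
- by rewrite (intE _ mid) (intE _ mT).
- by rewrite (intE _ mid) lte_mul_pinfty ?lee_fin ?(ltW M0)// gauss_mass_lty.
move=> a a0; rewrite (minE _ _ a0 mid) (minE _ _ a0 mT).
apply: lee_wpmul2l; first by rewrite lee_fin ltW.
have aM : 0 < a / M by rewrite divr_gt0.
exact: (hinge_le s_gt0 T_lip aM mu).
Qed.
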